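(* Let $G$ be a t.d.l.c.s.c. group. Then there is a sequence of closed characteristic subgroups of $G$ \[ \{1\}\leqslant N\leqslant Q\leqslant G \] such that $N$ and $G/Q$ are elementary and $Q/N$ is elementary-free.
   Context: A t.d.l.c.s.c. group is a totally disconnected locally compact second countable (Hausdorff) topological group. The class $\mathscr{E}$ of elementary groups is the smallest class of t.d.l.c.s.c. groups such that: (i) $\mathscr{E}$ contains all second countable profinite groups and all countable discrete groups; (ii) if $G$ is a t.d.l.c.s.c. group and $H\trianglelefteq G$ is a closed normal subgroup with $H\in\mathscr{E}$ and $G/H$ either profinite or discrete, then $G\in\mathscr{E}$; (iii) if $G$ is a t.d.l.c.s.c. group and $G=\bigcup_{i\in\mathbb{N}}O_i$ where $(O_i)_{i\in\mathbb{N}}$ is an $\subseteq$-increasing sequence of open subgroups of $G$ with $O_i\in\mathscr{E}$ for each $i$, then $G\in\mathscr{E}$. A t.d.l.c.s.c. group is elementary-free if it has no non-trivial elementary closed normal subgroups and no non-trivial elementary Hausdorff quotients. A subgroup is characteristic if it is preserved by all topological group automorphisms. *)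

(* Defs.v *)
From HB Require Import structures.
From mathcomp Require Import all_boot.
From mathcomp Require Import all_classical.
From mathcomp Require Import topology.

Set Implicit Arguments.
Unset Strict Implicit.
Unset Printing Implicit Defensive.

Local Open Scope classical_set_scope.
Local Open Scope quotient_scope.
Local Open Scope group_scope.

HB.structure Definition PreTopologicalGroup :=
  {G of Topological G & Group G}.

HB.mixin Record PreTopologicalGroup_isTopologicalGroup G
    of PreTopologicalGroup G := {
  mulg_continuous : continuous (fun x : G * G => x.1 * x.2);
  invg_continuous : continuous (fun x : G => x^-1);
}.

#[short(type="topGroupType")]
HB.structure Definition TopologicalGroup :=
  {G of PreTopologicalGroup_isTopologicalGroup G & PreTopologicalGroup G}.

Record subgroup (G : topGroupType) := Subgroup {
  subgroup_set :> set G;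
  subgroupP : group_closed (mem subgroup_set) }.

Section SubgroupType.
Context {G : topGroupType} (H : subgroup G).

Definition subgroup_type : Type := set_type H.

HB.instance Definition _ := Topological.copy subgroup_type (set_type H).
HB.instance Definition _ := SubChoice.copy subgroup_type (set_type H).

Fact subgroup_group_closed : group_closed (fun x : G => x \in subgroup_set H).
Proof. exact: (subgroupP H). Qed.

HB.instance Definition _ := SubChoice_isSubGroup.Build G _ subgroup_type
  subgroup_group_closed.

End SubgroupType.

Section SubgroupTopology.
Context {G : topGroupType} (H : subgroup G).
Local Notation T := (subgroup_type H).

Let val_continuous : continuous (val : T -> G).
Proof. exact: initial_continuous. Qed.

Let to_subgroup_continuous (S : topologicalType) (f : S -> T) :
  continuous (val \o f) -> continuous f.
Proof.
move=> /continuousP cf; apply/continuousP => _ [B oB <-]; exact: (cf B oB).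
Qed.

Fact subgroup_mulg_continuous : continuous (fun x : T * T => x.1 * x.2).
Proof.
apply: to_subgroup_continuous => x.
rewrite (_ : _ \o _ = (fun y : G * G => y.1 * y.2) \o
  (fun y : T * T => (val y.1, val y.2))); last first.
  exact/funext.
apply: continuous_comp; last exact: mulg_continuous.
apply: cvg_pair => /=.
- by apply: continuous_comp; [exact: cvg_fst|exact: val_continuous].
- by apply: continuous_comp; [exact: cvg_snd|exact: val_continuous].
Qed.

Fact subgroup_invg_continuous : continuous (fun x : T => x^-1).
Proof.
apply: to_subgroup_continuous => x.
rewrite (_ : _ \o _ = (fun y : G => y^-1) \o (val : T -> G)); last first.
  exact/funext.
by apply: continuous_comp; [exact: val_continuous|exact: invg_continuous].
Qed.

HB.instance Definition _ := PreTopologicalGroup_isTopologicalGroup.Build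
  (subgroup_type H)  subgroup_mulg_continuous subgroup_invg_continuous.

End SubgroupTopology.

Definition normal (G : topGroupType) (H : set G) :=
  forall x y : G, H x -> H (x ^ y).

Record normal_subgroup (G : topGroupType) := NormalSubgroup {
  normal_subgroup_subgroup :> subgroup G;
  normal_subgroupP : normal normal_subgroup_subgroup }.

Section Quotient.
Context {G : topGroupType} (N : normal_subgroup G).

(* The left cosets x N are the classes of this relation. *)
Definition coset_rel (x y : G) : bool := x^-1 * y \in subgroup_set N.

Let N1 : (1 : G) \in subgroup_set N.
Proof. by case: (subgroupP N). Qed.

Let NV x : x \in subgroup_set N -> x^-1 \in subgroup_set N.
Proof. exact: (group_closedV (subgroupP N)). Qed.

Let NM x y : x \in subgroup_set N -> y \in subgroup_set N ->
  x * y \in subgroup_set N.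
Proof. exact: (group_closedM (subgroupP N)). Qed.

Let NJ x y : x \in subgroup_set N -> x ^ y \in subgroup_set N.
Proof. by rewrite !inE; exact: normal_subgroupP. Qed.

Fact coset_rel_refl : reflexive coset_rel.
Proof. by move=> x; rewrite /coset_rel mulVg. Qed.

Fact coset_rel_sym : symmetric coset_rel.
Proof.
by move=> x y; apply/idP/idP => /NV; rewrite /coset_rel invgM invgK.
Qed.

Fact coset_rel_trans : transitive coset_rel.
Proof.
move=> y x z xy yz; have := NM xy yz.
by rewrite /coset_rel mulgA mulgK.
Qed.

Canonical coset_equiv :=
  EquivRel coset_rel coset_rel_refl coset_rel_sym coset_rel_trans.

Definition quotient_group : Type := quotient_topology {eq_quot coset_equiv}.

HB.instance Definition _ := Topological.copy quotient_group
  (quotient_topology {eq_quot coset_equiv}).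
HB.instance Definition _ := Quotient.copy quotient_group
  (quotient_topology {eq_quot coset_equiv}).

Local Notation Q := quotient_group.
Local Notation pi := (\pi_Q : G -> Q).

Let piE x y : pi x = pi y <-> x^-1 * y \in subgroup_set N.
Proof. by split=> [/eqquotP|xy]; [|exact/eqquotP]. Qed.

Let piK (q : Q) : pi (repr q) = q.
Proof. exact: reprK. Qed.

Definition quotient_mul (p q : Q) : Q := pi (repr p * repr q).
Definition quotient_one : Q := pi 1.
Definition quotient_inv (q : Q) : Q := pi (repr q)^-1.

Let pi_mul x y : quotient_mul (pi x) (pi y) = pi (x * y).
Proof.
apply/piE; set x' := repr _; set y' := repr _.
have xx : x'^-1 * x \in subgroup_set N by apply/piE; exact: piK.
have yy : y'^-1 * y \in subgroup_set N by apply/piE; exact: piK.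
rewrite (_ : _ * _ = (x'^-1 * x) ^ y' * (y'^-1 * y)); last first.
  by rewrite conjgE invgM !mulgA mulgK.
by apply: NM => //; exact: NJ.
Qed.

Let pi_inv x : quotient_inv (pi x) = pi x^-1.
Proof.
apply/piE; set x' := repr _; rewrite invgK.
have xx : x^-1 * x' \in subgroup_set N by apply/piE; exact/esym/piK.
have := NJ x^-1 xx.
by rewrite conjgE invgK mulgA mulVKg.
Qed.

Fact quotient_mulA : associative quotient_mul.
Proof.
by move=> p q r; rewrite -(piK p) -(piK q) -(piK r) !pi_mul mulgA.
Qed.

Fact quotient_mul1g : left_id quotient_one quotient_mul.
Proof. by move=> p; rewrite -(piK p) pi_mul mul1g. Qed.

Fact quotient_mulg1 : right_id quotient_one quotient_mul.
Proof. by move=> p; rewrite -(piK p) pi_mul mulg1. Qed.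

Fact quotient_mulVg : left_inverse quotient_one quotient_inv quotient_mul.
Proof. by move=> p; rewrite -(piK p) pi_inv pi_mul mulVg. Qed.

Fact quotient_mulgV : right_inverse quotient_one quotient_inv quotient_mul.
Proof. by move=> p; rewrite -(piK p) pi_inv pi_mul mulgV. Qed.

HB.instance Definition _ := isGroup.Build quotient_group quotient_mulA
  quotient_mul1g quotient_mulg1 quotient_mulVg quotient_mulgV.

Lemma quotient_piM x y : pi (x * y) = pi x * pi y.
Proof. by rewrite -pi_mul. Qed.

Lemma quotient_piV x : pi x^-1 = (pi x)^-1.
Proof. by rewrite -pi_inv. Qed.

Lemma quotient_pi_continuous : continuous pi.
Proof. exact: (@pi_continuous G {eq_quot coset_equiv}). Qed.

Lemma quotient_pi_open (U : set G) : open U -> open (pi @` U).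
Proof.
move=> oU; suff: open (pi @^-1` (pi @` U)) by [].
rewrite (_ : _ @^-1` _ =
    \bigcup_(n in subgroup_set N) ((fun x => x * n) @^-1` U)); last first.
  apply/seteqP; split=> x /=.
    move=> [y Uy /esym/piE xy]; exists (x^-1 * y); first exact/set_mem.
    by rewrite /= mulVKg.
  move=> [n Nn /= Uxn]; exists (x * n) => //; apply/esym/piE.
  by rewrite mulKg; exact/mem_set.
apply: bigcup_open => n _.
have /continuousP : continuous (fun x : G => x * n); last exact.
move=> x; apply: (@continuous_comp _ _ _ (fun x : G => (x, n))
  (fun z : G * G => z.1 * z.2)); last exact: mulg_continuous.
by apply: cvg_pair => /=; [exact: cvg_id|exact: cvg_cst].
Qed.

Let pi_nbhs (x : G) (U : set G) : nbhs x U -> nbhs (pi x) (pi @` U).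
Proof.
rewrite nbhsE => -[V [oV Vx] VU]; rewrite nbhsE.
exists (pi @` V); last exact: image_subset.
by split; [exact: quotient_pi_open|exists x].
Qed.

Fact quotient_mulg_continuous : continuous (fun x : Q * Q => x.1 * x.2).
Proof.
move=> [p q] W /=; rewrite -(piK p) -(piK q) -quotient_piM.
move=> /quotient_pi_continuous.
move=> /(@mulg_continuous G (repr p, repr q))[[U V] /= [nU nV] UVW].
exists (pi @` U, pi @` V); first by split; exact: pi_nbhs.
move=> [_ _] /= [[x Ux <-] [y Vy <-]].
by rewrite /= -quotient_piM; exact: (UVW (x, y)).
Qed.

Fact quotient_invg_continuous : continuous (fun x : Q => x^-1).
Proof.
move=> p W /=; rewrite -(piK p) -quotient_piV.
move=> /quotient_pi_continuous /(@invg_continuous G (repr p)) nW.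
apply: filterS (pi_nbhs nW) => _ [x Wx <-].
by rewrite /= -quotient_piV.
Qed.

HB.instance Definition _ := PreTopologicalGroup_isTopologicalGroup.Build
  quotient_group quotient_mulg_continuous quotient_invg_continuous.

End Quotient.

Section Restriction.
Context {G : topGroupType} (H : subgroup G).

(* K :&: H, seen as a subset of the group H; it is K itself when K `<=` H. *)
Definition restrict_set (K : set G) : set (subgroup_type H) :=
  (val : subgroup_type H -> G) @^-1` K.

Fact restrict_group_closed (K : subgroup G) :
  group_closed (mem (restrict_set K)).
Proof.
have [K1 KF] := subgroupP K; split=> [|x y].
  exact/mem_set/(set_mem K1).
move=> /set_mem Kx /set_mem Ky; apply/mem_set/set_mem.
exact: (KF (val x) (val y) (mem_set Kx) (mem_set Ky)).
Qed.

Definition restrict_subgroup (K : subgroup G) : subgroup (subgroup_type H) :=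
  Subgroup (restrict_group_closed K).

Fact restrict_normal (N : normal_subgroup G) : normal (restrict_subgroup N).
Proof.
by move=> x y; exact: (@normal_subgroupP G N (val x) (val y)).
Qed.

Definition restrict_normal_subgroup (N : normal_subgroup G) :
  normal_subgroup (subgroup_type H) := NormalSubgroup (@restrict_normal N).

End Restriction.

(* The Prop version of the axiom of discreteNbhsType. *)
Definition discrete_space (T : topologicalType) : Prop :=
  @nbhs T T = principal_filter.

(* Profinite groups in the topological sense: compact, Hausdorff and totally
   disconnected. Second countability is not part of the notion. *)
Definition profinite (G : topGroupType) : Prop :=
  [/\ compact [set: G], hausdorff_space G & totally_disconnected [set: G]].

Definition tdlcsc (G : topGroupType) : Prop :=
  [/\ hausdorff_space G, totally_disconnected [set: G],
      locally_compact [set: G] & @second_countable G].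

(* The smallest class with the closure properties below. The t.d.l.c.s.c.
   hypothesis is only needed in the last two clauses: second countable
   profinite groups and countable discrete groups are t.d.l.c.s.c. *)
Inductive elementary : topGroupType -> Prop :=
| elementary_profinite (G : topGroupType) :
    profinite G -> @second_countable G -> elementary G
| elementary_discrete (G : topGroupType) :
    discrete_space G -> countable [set: G] -> elementary G
| elementary_extension (G : topGroupType) (H : normal_subgroup G) :
    tdlcsc G -> closed H ->
    elementary (subgroup_type H) ->
    profinite (quotient_group H) \/ discrete_space (quotient_group H) ->
    elementary G
| elementary_union (G : topGroupType) (O : nat -> subgroup G) :
    tdlcsc G ->
    (forall i, open (O i)) ->
    (forall i, O i `<=` O i.+1) ->
    \bigcup_i O i = [set: G] ->
    (forall i, elementary (subgroup_type (O i))) ->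
    elementary G.

Definition elementary_free (G : topGroupType) : Prop :=
  [/\ tdlcsc G,
      forall N : normal_subgroup G,
        closed N -> elementary (subgroup_type N) -> N = [set 1] :> set G
    & forall N : normal_subgroup G,
        hausdorff_space (quotient_group N) -> elementary (quotient_group N) ->
        [set: quotient_group N] = [set 1]].

Definition topological_automorphism (G : topGroupType) (f : G -> G) : Prop :=
  [/\ {morph f : x y / x * y}, continuous f &
      exists g : G -> G, [/\ cancel f g, cancel g f & continuous g]].

Definition characteristic (G : topGroupType) (H : set G) : Prop :=
  forall f : G -> G, topological_automorphism f -> f @` H = H.

Lemma characteristic_normal (G : topGroupType) (H : set G) :
  characteristic H -> normal H.
Proof.
have conj_continuous (y : G) : continuous (fun x : G => x ^ y).
  have mul_cont (a b : G) : continuous (fun x : G => a * (x * b)).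
    move=> x; apply: (@continuous_comp _ _ _ (fun x : G => (a, x * b))
      (fun z : G * G => z.1 * z.2)); last exact: mulg_continuous.
    apply: cvg_pair => /=; first exact: cvg_cst.
    apply: (@continuous_comp _ _ _ (fun x : G => (x, b))
      (fun z : G * G => z.1 * z.2)); last exact: mulg_continuous.
    by apply: cvg_pair => /=; [exact: cvg_id|exact: cvg_cst].
  exact: mul_cont.
move=> chH x y Hx; rewrite -(chH (fun z => z ^ y)); first by exists x.
split; [by move=> u v; exact: conjMg|exact: conj_continuous|].
exists (fun x => x ^ y^-1); split; last exact: conj_continuous.
- exact: conjgK.
- exact: conjgKV.
Qed.

Definition characteristic_normal_subgroup (G : topGroupType) (H : subgroup G)
    (chH : characteristic H) : normal_subgroup G :=
  NormalSubgroup (characteristic_normal chH).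

(* Main.v *)
(* Let Q be the smallest closed normal subgroup of G with G/Q elementary, N the
   largest elementary closed normal subgroup of Q, and R the smallest closed
   normal subgroup of Q with Q/R elementary. All three are characteristic in G.
   An elementary closed normal subgroup of Q/N lifts to an elementary one of Q,
   hence is trivial; and G/R is an extension of elementary groups, so R = Q and
   Q/N has no elementary quotients.

   Existence of Q and N rests on the closure of the class under extensions,
   closed subgroups, quotients and residual limits. These are made accessible by
   a description without profinite quotients: H/N is elementary iff H can be
   reached from subgroups that are compact modulo N by extensions with discrete
   quotient and increasing unions of open subgroups. If V is compact and
   normalizes H, this passes from H to HV. If K maps continuously to a compact
   group, with kernel A, and W is a compact open subgroup of K, then the trace L
   on W of a small open normal subgroup of that compact group need not make AL
   normal in K; but every element of K normalizes AL as soon as L is small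
   enough, so K is an increasing union of open subgroups K_j having such an AL
   as an open normal subgroup. The same argument handles the intersection of a
   decreasing sequence of subgroups with elementary quotients, to which second
   countability reduces the general residual limit. *)

Require Import Defs.
From mathcomp Require Import all_boot.
From mathcomp Require Import all_classical.
From mathcomp Require Import topology.

Set Implicit Arguments.
Unset Strict Implicit.
Unset Printing Implicit Defensive.

Local Open Scope classical_set_scope.
Local Open Scope group_scope.

(** * Totally disconnected locally compact spaces *)

(** Otherwise the traces [A ∩ C] with [C] in [F] generate a proper filter on [A]; a cluster point in
    [A] lies in the closure of every [C], against the last hypothesis. *)
Lemma compact_directed (T : topologicalType) (A : set T) (F : set (set T)) :
    compact A -> F !=set0 ->
    (forall C D, F C -> F D -> exists2 E, F E & E `<=` C `&` D) ->
    (forall a, A a -> exists2 C, F C & ~ closure C a) ->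
  exists2 C, F C & forall a, A a -> ~ C a.
Proof.
move=> cA [C0 FC0] FI FA; apply: contrapT => nF.
have AF C : F C -> (A `&` C) !=set0.
  move=> FC; apply: contrapT => AC0; apply: nF; exists C => // a Aa Ca.
  by apply: AC0; exists a.
have PF : ProperFilter (filter_from F (fun C => A `&` C)).
  apply: filter_from_proper; last exact: AF.
  apply: filter_from_filter; first by exists C0.
  move=> C D FC FD; have [E FE ECD] := FI _ _ FC FD.
  by exists E => // x [Ax /ECD[Cx Dx]]; split.
have [|a [Aa]] := cA _ PF; first by exists C0 => // x [].
rewrite clusterE => cla; have [C FC] := FA _ Aa; apply.
have : closure (A `&` C) a by apply: cla; exists C.
by apply: closureS => x [].
Qed.

(** Two uses of [compact_directed]: the closed neighbourhoods of a point outside [A] shrink until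
    one misses [A], and then the closures of the open sets containing [A] shrink until one misses
    [B]. *)
Lemma hausdorff_compact_separated (T : topologicalType) (A B : set T) :
    hausdorff_space T -> compact A -> compact B -> A `&` B = set0 ->
  exists O, [/\ open O, A `<=` O & closure O `&` B = set0].
Proof.
move=> hT cA cB AB0.
have point y : ~ A y -> exists O, [/\ open O, O y & closure O `&` A = set0].
  move=> nAy; have [||C D|a Aa|O] :=
    @compact_directed T A [set closure O | O in open_nbhs y].
  - exact: cA.
  - by exists (closure setT), setT => //; split => //; exact: openT.
  - move=> [O1 o1 <-] [O2 o2 <-]; exists (closure (O1 `&` O2)).
      by exists (O1 `&` O2) => //; exact: open_nbhsI.
    exact: closureI.
  - have ay : a != y by apply/eqP => ay; apply: nAy; rewrite -ay.
    move: hT; rewrite open_hausdorff => /(_ _ _ ay)[[U V] /= [aU yV]].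
    move=> [oU oV /eqP UV0]; exists (closure V).
      by exists V => //; split => //; exact: set_mem.
    have -> : closure (closure V) = closure V.
      by rewrite -(closure_id (closure V)).1 //; exact: closed_closure.
    move=> /(_ U) []; first by apply: open_nbhs_nbhs; split => //; exact: set_mem.
    by move=> z [Vz Uz]; have : (U `&` V) z by []; rewrite UV0.
  - move=> [P [oP Py] <-] AP; exists P; split => //.
    by rewrite -subset0 => z [Pz Az]; exact: (AP z).
have [|C D|b Bb|O] := @compact_directed T B
  [set closure O | O in [set O | open O /\ A `<=` O]] cB.
- by exists (closure setT), setT => //; split => //; exact: openT.
- move=> [O1 [o1 A1] <-] [O2 [o2 A2] <-]; exists (closure (O1 `&` O2)).
    exists (O1 `&` O2) => //; split; first exact: openI.
    by move=> a Aa; split; [exact: A1|exact: A2].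
  exact: closureI.
- have [Ab|nAb] := pselect (A b).
    by have : (A `&` B) b by []; rewrite AB0.
  have [O [oO Ob OA0]] := point _ nAb.
  exists (closure (~` closure O)).
    exists (~` closure O) => //; split.
      exact/closed_openC/closed_closure.
    by move=> a Aa Oa; have : (closure O `&` A) a by []; rewrite OA0.
  rewrite -(closure_id (closure _)).1; last exact: closed_closure.
  move=> /(_ O) []; first exact: open_nbhs_nbhs.
  by move=> z [nOz Oz]; apply: nOz; exact: subset_closure.
- move=> [P [oP AP] <-] PB; exists P; split => //.
  by rewrite -subset0 => z [Pz Bz]; exact: (PB z).
Qed.

(* The intersection of the relatively clopen subsets of a compact neighbourhood
   that contain [x] is connected. *)
Lemma compact_open_basis (T : topologicalType) (x : T) (U : set T) :
    hausdorff_space T -> totally_disconnected [set: T] ->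
    locally_compact [set: T] -> nbhs x U ->
  exists C, [/\ compact C, open C, C x & C `<=` U].
Proof.
move=> hT tdT lcT nU.
have [K nK [cK clK]] := lcT x Logic.I.
have {}nK : nbhs x K.
  by apply: (@filterS _ (nbhs x) _ _ _ _ nK) => y; exact.
have : nbhs x (U `&` K) by exact: filterI.
rewrite nbhsE => -[U' [oU' U'x] U'UK].
pose F := [set C : set T | [/\ closed C, C `<=` K, C x &
  exists2 O, open O & C = K `&` O]].
have FK : F K.
  split => //; first exact: nbhs_singleton.
  by exists setT; [exact: openT|rewrite setIT].
have FI C D : F C -> F D -> F (C `&` D).
  move=> [c1 K1 x1 [O1 o1 e1]] [c2 K2 x2 [O2 o2 e2]]; split.
  - exact: closedI.
  - by move=> z [] /K1.
  - by split.
  - exists (O1 `&` O2); first exact: openI.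
    by rewrite e1 e2; apply/seteqP; split=> z /=; tauto.
(* [F] is stable under finite intersections, so a compact set that misses its intersection misses a
   single member. *)
have dirF E : compact E -> (forall z, E z -> exists2 C, F C & ~ C z) ->
    exists2 C, F C & forall z, E z -> ~ C z.
  move=> cE EF; apply: compact_directed => //.
  - by exists K.
  - by move=> C D FC FD; exists (C `&` D) => //; exact: FI.
  - move=> z /EF[C FC nCz]; exists C => //.
    by rewrite -(closure_id C).1 //; case: FC.
pose Q := \bigcap_(C in F) C.
have Qx : Q x by move=> C [].
have QK : Q `<=` K by move=> z; apply.
have clQ : closed Q by apply: closed_bigI => C [].
have conQ : connected Q.
  move=> B [b Bb] [O oO BO] [D cD BD].
  have BQ : B `<=` Q by rewrite BO => z [].
  have clB : closed B by rewrite BD; exact: closedI.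
  (* [B] and [Q] minus [B] are disjoint compact sets, so some open [O1] contains [B] and its closure
     meets [Q] only in [B]. Thus [Q] avoids the boundary of [O1], and so does some [C] in [F]. Now
     [O1] cuts [C] into two relatively clopen pieces; the piece containing [x] is in [F] and hence
     contains [Q]. *)
  have [||//|O1 [oO1 BO1 O1Q]] :=
    @hausdorff_compact_separated T B (Q `&` ~` O) hT.
  - exact: subclosed_compact cK (subset_trans BQ QK).
  - apply: subclosed_compact cK _; last by move=> z [/QK].
    by apply: closedI => //; exact: open_closedC.
  - by rewrite -subset0 {1}BO => z [[_ Oz] [_]].
  have QO1 z : Q z -> closure O1 z -> B z.
    move=> Qz Oz; rewrite BO; split => //; apply: contrapT => nO.
    by have : (closure O1 `&` (Q `&` ~` O)) z by []; rewrite O1Q.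
  have [||C FC Csep] := dirF (K `&` (closure O1 `&` ~` O1)).
  - apply: compact_closedI => //; apply: closedI; first exact: closed_closure.
    exact: open_closedC.
  - move=> z [Kz [clz nO1z]]; apply: contrapT => nF.
    suff Qz : Q z by apply: nO1z; exact/BO1/QO1.
    by move=> C FC; apply: contrapT => nCz; apply: nF; exists C.
  have [clC CK Cx [P oP CP]] := FC.
  have CO1 z : C z -> closure O1 z -> O1 z.
    move=> Cz cz; apply: contrapT => nz; apply: (Csep z) => //.
    by split => //; exact: CK.
  have [Bx|nBx] := pselect (B x).
    apply/seteqP; split => // q Qq; apply: QO1 => //; apply: subset_closure.
    suff [//] : (C `&` O1) q by [].
    apply: Qq; split; last first.
    - by exists (P `&` O1); [exact: openI|rewrite {1}CP setIA].
    - by split => //; exact: BO1.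
    - by move=> z [/CK].
    - have -> : C `&` O1 = C `&` closure O1.
        apply/seteqP; split=> z [Cz Oz]; split => //.
          exact: subset_closure.
        exact: CO1.
      by apply: closedI => //; exact: closed_closure.
  exfalso; suff [_] : (C `&` ~` O1) b by apply; exact: BO1.
  apply: (BQ _ Bb); split; last first.
  - exists (P `&` ~` closure O1).
      by apply: openI => //; exact/closed_openC/closed_closure.
    rewrite setIA -CP; apply/seteqP; split=> z [Cz Oz]; split => // ?.
      by apply: Oz; exact: CO1.
    by apply: Oz; exact: subset_closure.
  - split => // O1x; apply: nBx; apply: QO1 => //; exact: subset_closure.
  - by move=> z [/CK].
  - by apply: closedI => //; exact: open_closedC.
have Q1 : Q `<=` [set x].
  by rewrite -(tdT x Logic.I); exact: connected_component_max.
have [||C FC Csep] := dirF (K `&` ~` U').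
- by apply: compact_closedI => //; exact: open_closedC.
- move=> z [Kz nU'z]; apply: contrapT => nF; apply: nU'z.
  suff /Q1 -> : Q z by [].
  by move=> C FC; apply: contrapT => nCz; apply: nF; exists C.
have [clC CK Cx [P oP CP]] := FC.
have CU' : C `<=` U'.
  move=> z Cz; apply: contrapT => nz; apply: (Csep z) => //.
  by split => //; exact: CK.
exists C; split => //.
- exact: subclosed_compact cK CK.
- have -> : C = U' `&` P.
    apply/seteqP; split=> z.
      by move=> Cz; split; [exact: CU'|move: Cz; rewrite CP => -[]].
    by move=> [/U'UK[_ Kz] Pz]; rewrite CP.
  exact: openI.
- by move=> z /CU' /U'UK[].
Qed.

(** * Subgroups of topological groups *)

(** A predicate on subsets of one group: chains of subgroups can be multiplied, intersected and
    compared without a change of carrier type. *)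
Record is_subgroup (G : topGroupType) (H : set G) : Prop := IsSubgroup {
  sub1 : H 1;
  subM : forall x y, H x -> H y -> H (x * y);
  subV : forall x, H x -> H x^-1 }.

Definition normalizes (G : topGroupType) (H N : set G) :=
  forall n h, N n -> H h -> N (n ^ h).

(* For subgroups [L] of [H]: [L] is open in [H]. *)
Definition relopen (G : topGroupType) (L H : set G) :=
  \forall x \near (1 : G), H x -> L x.

Definition mulset (G : topGroupType) (A B : set G) : set G :=
  [set x | exists a b, [/\ A a, B b & x = a * b]].

Section Topology.
Context {G : topGroupType}.
Implicit Types (x y : G) (A B C H L N U V W : set G).

Lemma continuousM (T : topologicalType) (f g : T -> G) t :
  {for t, continuous f} -> {for t, continuous g} ->
  {for t, continuous (fun t => f t * g t)}.
Proof.
move=> cf cg; apply: (@continuous_comp _ _ _ (fun t => (f t, g t))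
  (fun z : G * G => z.1 * z.2)); last exact: mulg_continuous.
exact: cvg_pair.
Qed.

Lemma continuousV (T : topologicalType) (f : T -> G) t :
  {for t, continuous f} -> {for t, continuous (fun t => (f t)^-1)}.
Proof.
by move=> cf; apply: continuous_comp => //; exact: invg_continuous.
Qed.

Lemma mull_continuous x : continuous (fun y : G => x * y).
Proof. by move=> y; apply: continuousM; [exact: cvg_cst|exact: cvg_id]. Qed.

Lemma mulr_continuous x : continuous (fun y : G => y * x).
Proof. by move=> y; apply: continuousM; [exact: cvg_id|exact: cvg_cst]. Qed.

Lemma conj_continuous x : continuous (fun y : G => y ^ x).
Proof.
move=> y; apply: (@continuousM G (fun=> x^-1) (fun y => y * x)).
  exact: cvg_cst.
exact: mulr_continuous.
Qed.

Lemma near_mull x W : nbhs x W -> \forall y \near (1 : G), W (x * y).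
Proof.
by move=> nW; have /= := @mull_continuous x 1 W; rewrite mulg1; exact.
Qed.

Lemma near_mulr x W : nbhs x W -> \forall y \near (1 : G), W (y * x).
Proof.
by move=> nW; have /= := @mulr_continuous x 1 W; rewrite mul1g; exact.
Qed.

Lemma near_divl x W : nbhs 1 W -> \forall y \near x, W (x^-1 * y).
Proof.
by move=> nW; have /= := @mull_continuous x^-1 x W; rewrite mulVg; exact.
Qed.

Lemma near_divr x W : nbhs 1 W -> \forall y \near x, W (y^-1 * x).
Proof.
move=> nW.
have := @continuousM G (fun y => y^-1) (fun=> x) x
  (continuousV (@cvg_id _ _)) (cvg_cst _) W.
by rewrite mulVg; exact.
Qed.

Lemma near_conj x W : nbhs 1 W -> \forall y \near (1 : G), W (y ^ x).
Proof.
by move=> nW; have /= := @conj_continuous x 1 W; rewrite conj1g; exact.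
Qed.

(** The tube lemma for the continuous map sending [(c, y)] to [y ^ c], which takes the value 1 on
    all of [C × {1}]. *)
Lemma near_conj_compact C W : compact C -> nbhs 1 W ->
  \forall y \near (1 : G), forall c, C c -> W (y ^ c).
Proof.
move=> /compact_near_coveringP cC nW.
apply: (cC _ _ (fun y c => W (y ^ c))) => c _ /=.
have cf : {for (c, 1 : G), continuous (fun z : G * G => z.2 ^ z.1)}.
  apply: (@continuousM _ (fun z : G * G => z.1^-1) (fun z => z.2 * z.1)).
    by apply: continuousV; exact: cvg_fst.
  by apply: continuousM; [exact: cvg_snd|exact: cvg_fst].
by move: (cf W) => /=; rewrite conj1g => /(_ nW).
Qed.

Lemma open_near H : (forall x, H x -> \forall y \near (1 : G), H (x * y)) ->
  open H.
Proof.
move=> nH; rewrite openE => x /nH /(near_divl x) nx.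
by apply: filterS nx => y; rewrite mulVKg.
Qed.

Lemma open_subgroup H : is_subgroup H -> relopen H setT -> open H.
Proof.
move=> sH; rewrite /relopen => oH.
apply: open_near => x Hx; apply: (filterS _ oH) => y Hy.
by apply: (subM sH) => //; exact: Hy.
Qed.

(** A point [x] of the closure of [L] is close to some [y] in [L]; then [y^-1 * x] lies in [H] and
    is close to 1, hence lies in [L]. *)
Lemma relopen_closed H L : is_subgroup L -> L `<=` H -> closed H ->
  is_subgroup H -> relopen L H -> closed L.
Proof.
move=> sL LH cH sH oL x clx.
have Hx : H x by apply: cH => B /clx [y [/LH Hy By]]; exists y.
have [y [Ly HLy]] := clx _ (near_divr x oL).
rewrite -[x](mulVKg y); apply: (subM sL) => //; apply: HLy.
by apply: (subM sH) => //; apply: (subV sH); exact: LH.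
Qed.

Lemma subMV H x y : is_subgroup H -> H x -> H y -> H (x * y^-1).
Proof. by move=> sH Hx Hy; apply: (subM sH) => //; exact: subV. Qed.

Lemma subJ H x y : is_subgroup H -> H x -> H y -> H (x ^ y).
Proof.
by move=> sH Hx Hy; do 2?apply: (subM sH) => //; exact: subV.
Qed.

Lemma subgroupI H L : is_subgroup H -> is_subgroup L -> is_subgroup (H `&` L).
Proof.
move=> sH sL; split; first by split; exact: sub1.
  by move=> x y [? ?] [? ?]; split; exact: subM.
by move=> x [? ?]; split; exact: subV.
Qed.

Lemma normalizes_self H : is_subgroup H -> normalizes H H.
Proof. by move=> sH n h Hn Hh; exact: subJ. Qed.

Lemma normalizes_sub H K N : K `<=` H -> normalizes H N -> normalizes K N.
Proof. by move=> KH nN n h Nn /KH; exact: nN. Qed.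

Lemma normalizesI H L N : normalizes H N -> normalizes H L ->
  normalizes H (N `&` L).
Proof. by move=> nN nL n h [Nn Ln] Hh; split; [exact: nN|exact: nL]. Qed.

Lemma relopen_trans A B C : relopen A B -> relopen B C -> relopen A C.
Proof. by rewrite /relopen; apply: filterS2 => x AB BC /BC. Qed.

Lemma relopen_sub A B C : relopen A C -> B `<=` C -> relopen A B.
Proof. by rewrite /relopen => + BC; apply: filterS => x AC /BC. Qed.

Lemma relopen_sup A B C : relopen A C -> A `<=` B -> relopen B C.
Proof. by rewrite /relopen => + AB; apply: filterS => x AC /AC/AB. Qed.

Lemma relopenI A B C : relopen A C -> relopen B C -> relopen (A `&` B) C.
Proof.
rewrite /relopen; apply: filterS2 => x hA hB Cx.
by split; [exact: hA|exact: hB].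
Qed.

Lemma relopenII A B C : relopen A B -> relopen (A `&` C) (B `&` C).
Proof. by rewrite /relopen; apply: filterS => x AB [/AB]. Qed.

Lemma relopenxx A : relopen A A.
Proof. by rewrite /relopen; exact: filterE. Qed.

Lemma mulset_subl A B : B 1 -> A `<=` mulset A B.
Proof. by move=> B1 a Aa; exists a, 1; rewrite mulg1. Qed.

Lemma mulset_subr A B : A 1 -> B `<=` mulset A B.
Proof. by move=> A1 b Bb; exists 1, b; rewrite mul1g. Qed.

Lemma mulset_sub A B H : is_subgroup H -> A `<=` H -> B `<=` H ->
  mulset A B `<=` H.
Proof. by move=> sH AH BH _ [a [b [/AH Ha /BH Hb ->]]]; exact: subM. Qed.

Lemma mulset_subgroup H V : is_subgroup H -> is_subgroup V -> normalizes V H ->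
  is_subgroup (mulset H V).
Proof.
move=> sH sV nVH; split.
- by exists 1, 1; rewrite mulg1; split => //; exact: sub1.
- move=> _ _ [h [v [Hh Vv ->]]] [k [w [Hk Vw ->]]].
  exists (h * k ^ v^-1), (v * w); split; last by rewrite conjgE !gnorm.
    by apply: (subM sH) => //; apply: nVH => //; exact: subV.
  exact: subM.
- move=> _ [h [v [Hh Vv ->]]]; exists (h^-1 ^ v), v^-1; split.
  + by apply: nVH => //; exact: subV.
  + exact: subV.
  + by rewrite conjgE !gnorm.
Qed.

Lemma normalizes_mulset H V W : is_subgroup W -> normalizes H W ->
  normalizes V W -> normalizes (mulset H V) W.
Proof.
move=> sW nH nV n _ Wn [h [v [Hh Vv ->]]].
by rewrite conjgM; apply: nV => //; exact: nH.
Qed.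

Lemma mulset_normalizes H V W : normalizes H V ->
  normalizes H W -> normalizes H (mulset V W).
Proof.
move=> nV nW _ h [v [w [Vv Ww ->]]] Hh; exists (v ^ h), (w ^ h).
by split; [exact: nV|exact: nW|exact: conjMg].
Qed.

Lemma mulset_compact A B : compact A -> compact B -> compact (mulset A B).
Proof.
move=> cA cB.
rewrite (_ : mulset A B = (fun z : G * G => z.1 * z.2) @` (A `*` B)).
  apply: continuous_compact; last exact: compact_setX.
  exact/continuous_subspaceT/mulg_continuous.
apply/seteqP; split=> x.
  by move=> [a [b [Aa Bb ->]]]; exists (a, b).
by move=> [[a b] [/= Aa Bb] <-]; exists a, b.
Qed.

(** [V] is the stabilizer of a compact open neighbourhood [U] of 1 under left translation.
    Compactness of [U] makes [V] open; [V] is contained in [U] because 1 is in [U], and it is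
    compact because an open subgroup is closed. *)
Lemma van_dantzig W : hausdorff_space G -> totally_disconnected [set: G] ->
    locally_compact [set: G] -> nbhs (1 : G) W ->
  exists V, [/\ is_subgroup V, compact V, relopen V setT & V `<=` W].
Proof.
move=> hG tdG lcG nW.
have [U [cU oU U1 UW]] := compact_open_basis hG tdG lcG nW.
pose S := [set x : G | forall u, U u -> U (x * u)].
have nS : \forall x \near (1 : G), S x.
  move: cU => /compact_near_coveringP cU.
  apply: (cU _ _ (fun x u => U (x * u))) => u Uu /=.
  have := @mulg_continuous G (1, u) U.
  rewrite /= mul1g => /(_ (open_nbhs_nbhs (conj oU Uu))) [[P Q] [nP nQ] PQ].
  exists (Q, P); first by split.
  by move=> [q p] /= [Qq Pp]; apply: (PQ (p, q)).
pose V := [set x : G | S x /\ S x^-1].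
have sV : is_subgroup V.
  split; first by split=> u; rewrite ?invg1 mul1g.
    move=> x y [Sx SVx] [Sy SVy]; split=> u Uu.
      by rewrite -mulgA; apply: Sx; exact: Sy.
    by rewrite invgM -mulgA; apply: SVy; exact: SVx.
  by move=> x [Sx SVx]; split; rewrite ?invgK.
have VU : V `<=` U by move=> x [/(_ 1 U1)]; rewrite mulg1.
have oV : relopen V setT.
  have nSV : \forall x \near (1 : G), S x^-1.
    by have := @invg_continuous G 1 S; rewrite invg1; exact.
  by apply: filterS2 nS nSV.
exists V; split => //; last exact: subset_trans UW.
apply: (subclosed_compact _ cU VU).
by apply: (relopen_closed sV _ closedT) => //; split.
Qed.

End Topology.

(** * Groups built from compact ones by discrete extensions and unions *)

(* [elementary_over N H] says that [H / N] is elementary. In contrast with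
   [elementary], extensions have discrete quotients only: profinite quotients
   come for free. *)
Inductive elementary_over (G : topGroupType) (N : set G) : set G -> Prop :=
| over_compact H C : is_subgroup H -> N `<=` H -> compact C ->
    H `<=` mulset N C -> elementary_over N H
| over_ext L H : is_subgroup H -> L `<=` H -> normalizes H L ->
    relopen L H -> elementary_over N L -> elementary_over N H
| over_union (O : nat -> set G) H : is_subgroup H ->
    (forall i, O i `<=` O i.+1) -> (forall i, relopen (O i) H) ->
    H = \bigcup_i O i -> (forall i, elementary_over N (O i)) ->
    elementary_over N H.

Definition subgroup_basis (G : topGroupType) (U : nat -> set G) : Prop :=
  [/\ forall k, is_subgroup (U k), forall k, compact (U k),
      forall k, relopen (U k) setT, forall k, U k.+1 `<=` U k &
      forall W : set G, nbhs (1 : G) W -> exists k, U k `<=` W].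

Section ElementaryOver.
Context {G : topGroupType}.
Implicit Types (x y : G) (A B C H K L M N V W : set G).

Lemma over_subgroup N H : elementary_over N H -> is_subgroup H.
Proof. by case. Qed.

Lemma over_ge N H : elementary_over N H -> N `<=` H.
Proof.
elim=> {H} [//|L H _ LH _ _ _ NL|O H _ _ _ -> _ NO] x Nx; first exact/LH/NL.
by exists 0 => //; exact: NO.
Qed.

Lemma decreasing_subset (U : nat -> set G) i j : (forall k, U k.+1 `<=` U k) ->
  i <= j -> U j `<=` U i.
Proof.
move=> dU /subnK <-; elim: (j - i) => [//|k IH].
by rewrite addSn; exact: subset_trans IH.
Qed.

Lemma increasing_subset (U : nat -> set G) i j : (forall k, U k `<=` U k.+1) ->
  i <= j -> U i `<=` U j.
Proof.
move=> dU /subnK <-; elim: (j - i) => [//|k IH].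
by rewrite addSn; apply: subset_trans (dU _).
Qed.

Lemma mulset_relopen A V K : A 1 -> relopen V K -> relopen (mulset A V) K.
Proof. by move=> A1 /relopen_sup; apply; exact: mulset_subr. Qed.

Lemma subset_mulset A A' B B' : A `<=` A' -> B `<=` B' ->
  mulset A B `<=` mulset A' B'.
Proof. by move=> sA sB _ [a [b [/sA ? /sB ? ->]]]; exists a, b. Qed.

(* For [V] compact normalizing [H] and [L] open in [H], this intersection of
   infinitely many conjugates is still open in [H], by the tube lemma. *)
Definition conj_core H V L := [set x | H x /\ forall v, V v -> L (x ^ v)].

Lemma conj_core_subset H V L : is_subgroup V -> conj_core H V L `<=` L.
Proof. by move=> sV x [_ /(_ 1 (sub1 sV))]; rewrite conjg1. Qed.

Lemma conj_core_normalized H V L K : is_subgroup V -> K `<=` V ->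
  normalizes K H -> normalizes K (conj_core H V L).
Proof.
move=> sV KV nKH x k [Hx Lx] Kk; split; first exact: nKH.
by move=> v Vv; rewrite -conjgM; apply: Lx; apply: subM => //; exact: KV.
Qed.

Lemma conj_core_normal H V L K : is_subgroup H -> normalizes V H -> H `<=` K ->
  normalizes K L -> normalizes H (conj_core H V L).
Proof.
move=> sH nVH HK nL x h [Hx Lx] Hh; split; first exact: subJ.
move=> v Vv; rewrite conjJg; apply: nL; first exact: Lx.
by apply: HK; exact: nVH.
Qed.

Lemma conj_core_subgroup H V L : is_subgroup H -> is_subgroup L ->
  is_subgroup (conj_core H V L).
Proof.
move=> sH sL; split.
- by split; [exact: sub1|move=> v _; rewrite conj1g; exact: sub1].
- move=> x y [Hx Lx] [Hy Ly]; split; first exact: subM.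
  by move=> v Vv; rewrite conjMg; apply: (subM sL); [exact: Lx|exact: Ly].
- move=> x [Hx Lx]; split; first exact: subV.
  by move=> v Vv; rewrite conjVg; apply: (subV sL); exact: Lx.
Qed.

Lemma conj_core_relopen H V L K : normalizes V H -> compact V -> H `<=` K ->
  relopen L K -> relopen (conj_core H V L) H.
Proof.
move=> nVH cV HK oL; have := near_conj_compact cV oL.
rewrite /relopen; apply: filterS => x Lx Hx; split => // v Vv.
by apply: Lx => //; apply: HK; exact: nVH.
Qed.

Lemma conj_core_mono H V L L' : L `<=` L' -> conj_core H V L `<=` conj_core H V L'.
Proof. by move=> LL' x [Hx Lx]; split => // v /Lx/LL'. Qed.

Lemma conj_core_ge H V L N : N `<=` H -> N `<=` L -> normalizes V N ->
  N `<=` conj_core H V L.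
Proof.
by move=> NH NL nVN x Nx; split; [exact: NH|move=> v Vv; apply/NL/nVN].
Qed.

(* In the extension step, no open subgroup of [V] need act trivially on the
   discrete group [H0 / L0]; but [H0] is the increasing union of the subgroups
   [Hk k] on which [Vk k] acts trivially modulo [L0], and then [L0 Vk] is normal
   in [Hk V]. *)
Lemma over_mulset (U : nat -> set G) N H H0 V :
    hausdorff_space G -> subgroup_basis U ->
    elementary_over N H -> is_subgroup H0 -> N `<=` H0 -> H0 `<=` H ->
    is_subgroup V -> compact V -> normalizes V H0 -> normalizes V N ->
    relopen V (mulset H0 V) ->
  elementary_over N (mulset H0 V).
Proof.
move=> hG [sU _ oU dU bU] eH; elim: eH H0 V => {H}.
- move=> H C sH NH cC HNC H0 V sH0 NH0 H0H sV cV nVH nVN oV.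
  apply: (over_compact (C := mulset C V)).
  + exact: mulset_subgroup.
  + by apply: subset_trans NH0 _; apply: mulset_subl; exact: sub1.
  + exact: mulset_compact.
  + move=> _ [h [v [/H0H/HNC[n [c [Nn Cc ->]]] Vv ->]]].
    by exists n, (c * v); split => //; [exists c, v|rewrite mulgA].
- move=> L H sH LH nL oL eL IH H0 V sH0 NH0 H0H sV cV nVH nVN oV.
  pose L0 := conj_core H0 V L.
  have sL0 : is_subgroup L0.
    by apply: conj_core_subgroup => //; exact: over_subgroup eL.
  have L0H0 : L0 `<=` H0 by move=> x [].
  have oL0 : relopen L0 H0 by exact: conj_core_relopen oL.
  have nVL0 : normalizes V L0 by exact: conj_core_normalized.
  have nL0 : normalizes H0 L0 by exact: conj_core_normal nL.
  have NL0 : N `<=` L0 by apply: conj_core_ge => //; exact: over_ge eL.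
  (* The normal core of [U k] in [V]: a compact subgroup that is open and normal in [V]. *)
  pose Vk k := conj_core V V (U k).
  have sVk k : is_subgroup (Vk k) by exact: conj_core_subgroup.
  have VkV k : Vk k `<=` V by move=> x [].
  have oVk k : relopen (Vk k) V.
    by apply: (conj_core_relopen _ _ (subsetT _)) => //; exact: normalizes_self.
  have nVk k : normalizes V (Vk k).
    by apply: conj_core_normalized => //; exact: normalizes_self.
  have cVk k : compact (Vk k).
    apply: (subclosed_compact _ cV (VkV k)).
    by apply: (relopen_closed (sVk k) (VkV k)) => //; exact: compact_closed.
  pose Hk k := [set h | H0 h /\ forall v, Vk k v -> L0 [~ h, v]].
  have HkH0 k : Hk k `<=` H0 by move=> x [].
  have sHk k : is_subgroup (Hk k).
    split.
    + by split; [exact: sub1|move=> v _; rewrite comm1g; exact: sub1].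
    + move=> x y [Hx Lx] [Hy Ly]; split; first exact: subM.
      move=> v Vv; rewrite (_ : [~ _, _] = [~ x, v] ^ y * [~ y, v]).
        by apply: (subM sL0); [apply: nL0 => //; exact: Lx|exact: Ly].
      by rewrite !commgEl !conjgE !gnorm.
    + move=> x [Hx Lx]; split; first exact: subV.
      move=> v Vv; rewrite (_ : [~ _, _] = [~ x, v]^-1 ^ x^-1).
        apply: nL0; last exact: subV.
        by apply: (subV sL0); exact: Lx.
      by rewrite !commgEl !conjgE !gnorm.
  have L0Hk k : L0 `<=` Hk k.
    move=> x Lx; split; first exact: L0H0.
    move=> v Vv; rewrite commgEl; apply: (subM sL0); first exact: subV.
    by apply: nVL0 => //; exact: VkV Vv.
  have nVHk k : normalizes V (Hk k).
    move=> x w [Hx Lx] Vw; split; first exact: nVH.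
    move=> v Vv; rewrite -[v](conjgKV w) -conjRg; apply: nVL0 => //.
    by apply: Lx; apply: nVk => //; exact: subV.
  have HkS k : Hk k `<=` Hk k.+1.
    move=> x [Hx Lx]; split => // v Vv; apply: Lx.
    by apply: conj_core_mono Vv; exact: dU.
  have HkE : H0 = \bigcup_k Hk k.
    apply/seteqP; split=> [x Hx|x [k _ []] //].
    (* The commutator [[~ x, v]] tends to 1 as [v] does, and [L0] is open in [H0]; so [x] belongs to
       [Hk k] as soon as [U k] is small enough. *)
    have cx : \forall v \near (1 : G), H0 [~ x, v] -> L0 [~ x, v].
      have cc : {for (1 : G), continuous (fun v : G => [~ x, v])}.
        apply: (@continuousM G G (fun=> x^-1)); first exact: cvg_cst.
        apply: (@continuousM G G (fun v => v^-1) (fun v => x * v)).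
          by apply: continuousV; exact: cvg_id.
        exact: mull_continuous.
      move: (cc (fun z => H0 z -> L0 z)) => /=.
      by rewrite commg1; exact.
    have [k Uk] := bU _ cx; exists k => //; split => // v Vv.
    have Vv' : V v by exact: VkV Vv.
    apply: Uk; first exact: conj_core_subset Vv.
    by rewrite commgEl; apply: (subM sH0); [exact: subV|exact: nVH].
  have sL0V k : mulset L0 (Vk k) `<=` mulset (Hk k) V by exact: subset_mulset.
  have HkV k : mulset (Hk k) V `<=` mulset H0 V by exact: subset_mulset.
  have oVkH k : relopen (Vk k) (mulset (Hk k) V).
    by apply: relopen_sub (HkV k); exact: relopen_trans oV.
  have sHkV k : is_subgroup (mulset (Hk k) V) by exact: mulset_subgroup.
  apply: (@over_union _ _ (fun k => mulset (Hk k) V)).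
  + exact: mulset_subgroup.
  + by move=> k; exact: subset_mulset.
  + move=> k; apply: relopen_sup oV _; apply: mulset_subr; exact: sub1.
  + apply/seteqP; split=> [_ [x [v [Hx Vv ->]]]|x [k _ /HkV] //].
    by move: Hx; rewrite HkE => -[k _ Hx]; exists k => //; exists x, v.
  + move=> k; apply: (@over_ext _ _ (mulset L0 (Vk k))) => //.
    * apply: normalizes_mulset; last by apply: mulset_normalizes.
        apply: mulset_subgroup => //; exact: normalizes_sub nVL0.
      move=> _ h [l [v [Ll Vv ->]]] [Hh Lh].
      (* Conjugation by [h] in [Hk k] moves [v] only by an element of [L0], which is why [L0 Vk] is
         normalized by [Hk k]. *)
      have -> : (l * v) ^ h = (l ^ h * ([~ h, v]^-1 ^ v^-1)) * v.
        by rewrite commgEl !conjgE !gnorm.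
      exists (l ^ h * ([~ h, v]^-1 ^ v^-1)), v; split => //.
      apply: (subM sL0); first exact: nL0.
      apply: nVL0; last by apply: subV => //; exact: VkV Vv.
      by apply: (subV sL0); exact: Lh.
    * by apply: mulset_relopen => //; exact: sub1.
    * apply: IH => //.
      - exact: conj_core_subset.
      - exact: normalizes_sub nVL0.
      - exact: normalizes_sub nVN.
      - apply: relopen_sub (oVkH k) _; exact: sL0V.
- move=> O H sH dO oO HO eO IH H0 V sH0 NH0 H0H sV cV nVH nVN oV.
  pose Hk k := conj_core H0 V (O k).
  have HkH0 k : Hk k `<=` H0 by move=> x [].
  have sHk k : is_subgroup (Hk k).
    by apply: conj_core_subgroup => //; exact: over_subgroup (eO k).
  have HkE : H0 = \bigcup_k Hk k.
    apply/seteqP; split=> [x Hx|x [k _ []] //].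
    (* The conjugates of [x] by the compact set [V] lie in a single [O k]: each [x ^ v] is in some
       [O i], and so are the [x ^ w] for [w] in [V] near [v]. *)
    have [] : \forall k \near \oo, V `<=` (fun v => O k (x ^ v)).
      move/compact_near_coveringP/near_covering_withinP : (cV); apply => v Vv.
      have : H (x ^ v) by apply/H0H/nVH.
      rewrite HO => -[i _ Oi].
      have cx : \forall w \near v, H ((x ^ v)^-1 * x ^ w) ->
          O i ((x ^ v)^-1 * x ^ w).
        have cw : {for v, continuous (fun w : G => (x ^ v)^-1 * x ^ w)}.
          apply: (@continuousM G G (fun=> (x ^ v)^-1)); first exact: cvg_cst.
          apply: (@continuousM G G (fun w => w^-1) (fun w => x * w)).
            by apply: continuousV; exact: cvg_id.
          exact: mull_continuous.
        by have := cw _ ; rewrite mulVg => /(_ _ (oO i)).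
      exists ((fun w => H ((x ^ v)^-1 * x ^ w) -> O i ((x ^ v)^-1 * x ^ w)),
        [set k | i <= k]).
        by split => //; exists i.
      move=> [w k] /= [Ow ik] Vw; apply: (increasing_subset dO ik).
      rewrite -[x ^ w](mulVKg (x ^ v)); apply: subM => //.
        exact: over_subgroup (eO i).
      apply: Ow; apply: subM => //; last exact/H0H/nVH.
      by apply: subV => //; exact/H0H/nVH.
    by move=> k _ /(_ k (leqnn k)) Ok; exists k.
  apply: (@over_union _ _ (fun k => mulset (Hk k) V)).
  + exact: mulset_subgroup.
  + by move=> k; apply: subset_mulset => //; exact: conj_core_mono.
  + move=> k; apply: relopen_sup oV _; apply: mulset_subr; exact: sub1.
  + apply/seteqP; split=> [_ [x [v [Hx Vv ->]]]|x [k _]].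
      by move: Hx; rewrite HkE => -[k _ Hx]; exists k => //; exists x, v.
    exact: subset_mulset.
  + move=> k; apply: IH => //.
    * by apply: conj_core_ge => //; exact: over_ge (eO k).
    * exact: conj_core_subset.
    * exact: conj_core_normalized.
    * by apply: relopen_sub oV _; exact: subset_mulset.
Qed.

End ElementaryOver.

(** * Elementary subgroups from homomorphisms with elementary kernel *)

Section Lifting.
Context {G : topGroupType}.
Implicit Types (x y : G) (A B C H K L M N V W : set G).

(* Fix [x] in [K] and let [W'] be the open subgroup of those [w] in [W] whose
   conjugates by [x] and [x^-1] are in [W]. By compactness [W `&` L j] is
   contained in [A W'] for large [j], and then [x] normalizes
   [mulset A (W `&` L j)]. *)
Lemma over_ext_chain (L : nat -> set G) K W A :
    is_subgroup K -> is_subgroup W -> W `<=` K -> compact W -> relopen W K ->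
    is_subgroup A -> A `<=` K -> normalizes K A ->
    (forall j, is_subgroup (L j)) -> (forall j, closed (L j)) ->
    (forall j, L j.+1 `<=` L j) -> (forall j, A `<=` L j) ->
    (forall j, normalizes K (L j)) ->
    W `&` \bigcap_j L j `<=` A ->
  exists Kj : nat -> set G,
    [/\ forall j, is_subgroup (Kj j), forall j, Kj j `<=` Kj j.+1,
        forall j, relopen (Kj j) K, K = \bigcup_j Kj j &
        forall j, mulset A (W `&` L j) `<=` Kj j /\
          normalizes (Kj j) (mulset A (W `&` L j))].
Proof.
move=> sK sW WK cW oW sA AK nKA sL clL dL AL nKL LA.
pose D j := mulset A (W `&` L j).
have sWL j : is_subgroup (W `&` L j) by exact: subgroupI.
have sD j : is_subgroup (D j).
  apply: mulset_subgroup => //; apply: normalizes_sub nKA.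
  by move=> x [/WK].
have AD j : A `<=` D j by apply: mulset_subl; exact: sub1.
have WD j : W `&` L j `<=` D j by apply: mulset_subr; exact: sub1.
have nWD j : normalizes W (D j).
  apply: mulset_normalizes; first exact: normalizes_sub nKA.
  apply: normalizesI; first exact: normalizes_self.
  exact: normalizes_sub (nKL j).
have nAD j : normalizes A (D j).
  by apply: (normalizes_sub (AD j)); exact: normalizes_self.
(* Normalizing [D i] for all [i >= j], and not only for [i = j], makes the sequence increasing;
   asking it of [x^-1] too makes each term a subgroup. *)
pose Kj j := [set x | K x /\ forall i d, j <= i -> D i d ->
  D i (d ^ x) /\ D i (d ^ x^-1)].
have WKj j : W `<=` Kj j.
  move=> x Wx; split; first exact: WK.
  by move=> i d _ Dd; split; apply: nWD => //; exact: subV.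
have AKj j : A `<=` Kj j.
  move=> x Ax; split; first exact: AK.
  by move=> i d _ Dd; split; apply: nAD => //; exact: subV.
have sKj j : is_subgroup (Kj j).
  split; first exact: (WKj j _ (sub1 sW)).
  - move=> x y [Kx Dx] [Ky Dy]; split; first exact: subM.
    move=> i d ji Dd; rewrite invgM !conjgM; split.
      by apply: (Dy _ _ ji _).1; exact: (Dx _ _ ji Dd).1.
    by apply: (Dx _ _ ji _).2; exact: (Dy _ _ ji Dd).2.
  - move=> x [Kx Dx]; split; first exact: subV.
    by move=> i d ji Dd; rewrite invgK; split; have [] := Dx _ _ ji Dd.
exists Kj; split => //.
- by move=> j x [Kx Dx]; split => // i d /ltnW; exact: Dx.
- by move=> j; exact: relopen_sup oW (WKj j).
- apply/seteqP; split=> [x Kx|x [j _ []] //].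
  pose W' := [set w | W w /\ (W (w ^ x) /\ W (w ^ x^-1))].
  have oW' : relopen W' K.
    have nW : nbhs 1 (fun w => K w -> W w) := oW.
    rewrite /relopen.
    apply: filterS (filterI nW (filterI (near_conj x nW) (near_conj x^-1 nW))).
    move=> w [W1 [W2 W3]] Kw; split; first exact: W1.
    by split; [apply: W2|apply: W3]; apply: subJ => //; exact: subV.
  have [] : \forall j \near \oo, W `<=` (fun w => L j w -> mulset A W' w).
    move/compact_near_coveringP/near_covering_withinP : (cW); apply => w Ww.
    (* If [w] is in every [L j], it is in [A], and nearby points of [W] are in [w W']. Otherwise
       some closed [L j] misses [w], and a neighbourhood of [w] misses all later [L i]. *)
    have [Lw|/existsNP[j nLw]] := pselect (forall j, L j w).
      have Aw : A w by apply: LA; split => // j _; exact: Lw.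
      exists ((fun z => K (w^-1 * z) -> W' (w^-1 * z)), setT).
        by split; [exact: near_divl oW'|exact: filterT].
      move=> [z i] /= [Wz _] Wz' _; exists w, (w^-1 * z).
      split => //; last by rewrite mulVKg.
      by apply: Wz; apply: subM => //; [apply: subV => //|]; exact: WK.
    exists (~` L j, [set i | j <= i]).
      split; last by exists j.
      by apply: open_nbhs_nbhs; split => //; exact: closed_openC.
    by move=> [z i] /= [nLz ji] _ Lz; case: nLz; exact: (decreasing_subset dL ji) Lz.
  move=> j _ LW'; exists j => //; split => // i d ji [a [w [Aa [Ww Lw] ->]]].
  have [b [v [Ab [Wv [Wvx Wvx']] wE]]] := LW' i ji _ Ww Lw.
  (* As [A] is contained in [L i], the factor [v] is in [L i] as well as in [W']; its conjugates by
     [x] and [x^-1] therefore stay in [W ∩ L i]. *)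
  have Lv : L i v.
    by rewrite -[v](mulKg b) -wE; apply: subM => //; apply: subV => //; exact: AL.
  have Dy y : K y -> W (v ^ y) -> D i ((a * w) ^ y).
    move=> Ky Wvy; exists ((a * b) ^ y), (v ^ y).
    split; last by rewrite wE mulgA conjMg.
      by apply: nKA => //; exact: subM.
    by split => //; exact: nKL.
  by split; apply: Dy => //; exact: subV.
- move=> j; split; last by move=> d x Dd [Kx Dx]; have [] := Dx _ _ (leqnn j) Dd.
  apply: mulset_sub => //; apply: (subset_trans _ (WKj j)).
  by move=> x [].
Qed.

(* A continuous homomorphism [K -> H/N] with elementary kernel has elementary
   source. *)
Lemma over_lift (U : nat -> set G) N H K M :
    hausdorff_space G -> subgroup_basis U ->
    elementary_over N H -> is_subgroup N -> closed N -> normalizes H N ->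
    is_subgroup K -> closed K -> K `<=` H -> normalizes K M ->
    elementary_over M (N `&` K) ->
  elementary_over M K.
Proof.
move=> hG bU eH sN cN; have [sU cU oU dU basisU] := bU.
elim: eH K => {H}.
- move=> H C sH NH cC HNC K nHN sK cK KH nKM eM.
  pose A := N `&` K; pose W := U 0 `&` K.
  have sA : is_subgroup A by exact: subgroupI.
  have AK : A `<=` K by move=> x [].
  have nKA : normalizes K A.
    by apply: normalizesI; [exact: normalizes_sub nHN|exact: normalizes_self].
  have WK : W `<=` K by move=> x [].
  have sW : is_subgroup W by exact: subgroupI.
  have cW : compact W by exact: compact_closedI.
  have oW : relopen W K by have := relopenII K (oU 0); rewrite setTI.
  pose T j := mulset N (U j `&` H).
  have sT j : is_subgroup (T j).
    apply: mulset_subgroup => //; first exact: subgroupI.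
    by apply: normalizes_sub nHN => x [].
  have NT j : N `<=` T j by apply: mulset_subl; split; exact: sub1.
  (* Taking all conjugates by [H] makes [L j] normal in [K]. It remains open, because modulo [N]
     only conjugation by the compact set [C] matters. *)
  pose L j := conj_core K H (T j).
  have LK j : L j `<=` K by move=> x [].
  have sL j : is_subgroup (L j) by exact: conj_core_subgroup.
  have oL j : relopen (L j) K.
    have := near_conj_compact cC (oU j).
    rewrite /relopen; apply: filterS => x Ux Kx; split => // h Hh.
    have [n [c [Nn Cc hE]]] := HNC _ Hh.
    have Hc : H c.
      rewrite -[c](mulKg n) -hE; apply: subM => //.
      by apply: subV => //; exact: NH.
    have -> : x ^ h = x ^ c * ((n^-1 ^ x) * n) ^ c.
      by rewrite hE !conjgE !gnorm.
    apply: subM => //.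
      apply: (mulset_subr (sub1 sN)); split; first exact: Ux.
      by apply: subJ => //; exact: KH.
    apply: NT; apply: (nHN) => //; apply: subM => //.
    by apply: nHN; [exact: subV|exact: KH].
  have cL j : closed (L j) by exact: relopen_closed (oL j).
  have AL j : A `<=` L j.
    by move=> x [Nx Kx]; split => // h Hh; apply: NT; exact: nHN.
  have nKL j : normalizes K (L j).
    by apply: conj_core_normalized => //; exact: normalizes_self.
  have [||Kj [sKj dKj oKj KE DKj]] :=
    over_ext_chain (L := L) sK sW WK cW oW sA AK nKA sL cL _ AL nKL.
  + move=> j; apply: conj_core_mono; apply: subset_mulset => // x [Ux Hx].
    by split => //; exact: dU.
  (* An element of every [L j] is a product [n * u] with [n] in [N] and [u] arbitrarily small, so it
     lies in the closure of [N]. *)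
  + move=> x [[_ Kx] Lx]; split => //; apply: cN => B Bx.
    have [k Uk] := basisU _ (near_mull Bx).
    have [n [u [Nn [Uu _] xE]]] := conj_core_subset sH (Lx k Logic.I).
    exists n; split => //; rewrite -[n](mulgK u) -xE.
    by apply: Uk; exact: subV.
  apply: over_union (KE) _ => // j.
  have [DK nD] := DKj j.
  have oWL : relopen (W `&` L j) K by exact: relopenI.
  (* [Kj j] has the open normal subgroup [A (W ∩ L j)], a product of [A], elementary over [M], with
     a compact group; [over_mulset] covers it. *)
  apply: over_ext nD _ _ => //.
    apply: mulset_relopen; first exact: sub1.
    by apply: relopen_sub oWL _; rewrite KE => x Kx; exists j.
  apply: over_mulset hG bU (eM) _ _ _ _ _ _ _ _ => //.
  + exact: over_ge eM.
  + exact: subgroupI.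
  + exact: compact_closedI.
  + by apply: normalizes_sub nKA => x [/WK].
  + by apply: normalizes_sub nKM => x [/WK].
  + by apply: relopen_sub oWL _; apply: mulset_sub => // x [/WK].
- move=> L H sH LH nL oL eL IH K nHN sK cK KH nKM eM.
  have sL := over_subgroup eL.
  have LKK : L `&` K `<=` K by move=> x [].
  have sLK : is_subgroup (L `&` K) by exact: subgroupI.
  have oLK : relopen (L `&` K) K.
    by apply: relopenI; [exact: relopen_sub oL KH|exact: relopenxx].
  apply: over_ext (oLK) _ => //.
    apply: normalizesI; last exact: normalizes_self.
    exact: normalizes_sub nL.
  apply: IH => //.
  + exact: normalizes_sub nHN.
  + exact: relopen_closed oLK.
  + exact: normalizes_sub nKM.
  + rewrite setIA (_ : N `&` L = N) //; apply/setIidPl; exact: over_ge eL.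
- move=> O H sH dO oO HO eO IH K nHN sK cK KH nKM eM.
  have OH i : O i `<=` H by rewrite HO => x Ox; exists i.
  have sOK i : is_subgroup (O i `&` K).
    by apply: subgroupI => //; exact: over_subgroup (eO i).
  have OKK i : O i `&` K `<=` K by move=> x [].
  have oOK i : relopen (O i `&` K) K.
    by apply: relopenI; [exact: relopen_sub (oO i) KH|exact: relopenxx].
  apply: (@over_union _ _ (fun i => O i `&` K)) => //.
  + by move=> i x [/dO]; split.
  + apply/seteqP; split=> [x Kx|x [i _ []] //].
    by have := KH _ Kx; rewrite HO => -[i _ Ox]; exists i.
  + move=> i; apply: IH => //.
    * exact: normalizes_sub nHN.
    * exact: relopen_closed (oOK i).
    * exact: normalizes_sub nKM.
    * rewrite setIA (_ : N `&` O i = N) //; apply/setIidPl.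
      exact: over_ge (eO i).
Qed.

Lemma over_refl N : is_subgroup N -> elementary_over N N.
Proof.
move=> sN; apply: (over_compact (C := [set 1])) => //; first exact: compact_set1.
by apply: mulset_subl.
Qed.

End Lifting.

(** * The elementary residual and the elementary radical *)

(** An injection of the basis into the naturals provides the indices; an index without a basic set
    receives the whole space. *)
Lemma second_countable_enum (T : topologicalType) : @second_countable T ->
  exists B : nat -> set T, (forall n, open (B n)) /\
    forall x W, nbhs x W -> exists2 n, B n x & B n `<=` W.
Proof.
move=> [B /countable_injP[f injf] [oB bB]].
have /choice[e eP] n : exists W, (open W) /\
    (forall W', B W' -> f W' = n -> W = W').
  have [[W BW fW]|nW] := pselect (exists2 W, B W & f W = n).
    exists W; split; first exact: oB.
    by move=> W' BW' fW'; apply: injf; rewrite ?inE // fW.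
  by exists setT; split; [exact: openT|move=> W BW fW; case: nW; exists W].
exists e; split; first by move=> n; have [] := eP n.
move=> x W /bB[W' [BW' W'x] W'W]; exists (f W').
  by rewrite (proj2 (eP _) _ BW' erefl).
by rewrite (proj2 (eP _) _ BW' erefl).
Qed.

Lemma closure_image (S T : topologicalType) (f : S -> T) (A : set S)
    (B : set T) : continuous f -> (forall x, A x -> B (f x)) ->
  forall x, closure A x -> closure B (f x).
Proof.
move=> cf AB x Ax W /cf nW; have [y [Ay Wy]] := Ax _ nW.
by exists (f y); split => //; exact: AB.
Qed.

Section ResidualRadical.
Context {G : topGroupType}.
Implicit Types (x y : G) (A B C H K L M N Q V W : set G).

Lemma subgroup_set1 : is_subgroup [set (1 : G)].
Proof.
by split => // [x y -> ->|x ->]; rewrite ?mulg1 ?invg1.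
Qed.

Lemma closure_subgroup H : is_subgroup H -> is_subgroup (closure H).
Proof.
move=> sH; have ccE : closure (closure H) = closure H.
  by rewrite -(closure_id (closure H)).1 //; exact: closed_closure.
(* One factor at a time: right translations by elements of [H] preserve the closure, and then left
   translations by elements of the closure do. *)
have MH x y : closure H x -> H y -> closure H (x * y).
  move=> clx Hy; apply: (@closure_image _ _ (mul^~ y) H) clx.
    exact: mulr_continuous.
  by move=> z Hz; exact: subM.
split; first by apply: subset_closure; exact: sub1.
- move=> x y clx cly; rewrite -ccE.
  apply: (@closure_image _ _ (mul x) H) cly; first exact: mull_continuous.
  by move=> z; exact: MH.
- move=> x clx; apply: (@closure_image _ _ (fun z : G => z^-1) H) clx;
    first exact: invg_continuous.
  by move=> z Hz; exact: subV.
Qed.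

Lemma closure_normalized H N : normalizes H N -> normalizes H (closure N).
Proof.
move=> nN x h clx Hh; apply: (@closure_image _ _ (conjg^~ h) N) clx.
  exact: conj_continuous.
by move=> z Nz; exact: nN.
Qed.

(** Finite intersections of compact open subgroups, one chosen inside each basic open set that
    contains 1. *)
Lemma exists_subgroup_basis : tdlcsc G ->
  exists U : nat -> set G, subgroup_basis U.
Proof.
move=> [hG tdG lcG /second_countable_enum[B [oB bB]]].
have /choice[V VP] n : exists V, [/\ is_subgroup V, compact V,
    relopen V setT & B n 1 -> V `<=` B n].
  have [Bn|nBn] := pselect (B n 1).
    have nB : nbhs 1 (B n) by apply: open_nbhs_nbhs; split.
    by have [V [? ? ? ?]] := van_dantzig hG tdG lcG nB; exists V; split.
  have [V [? ? ? _]] := van_dantzig hG tdG lcG (@filterT _ (nbhs (1 : G)) _).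
  by exists V; split.
pose U := fix U k := if k is k'.+1 then U k' `&` V k'.+1 else V 0.
have UV k : U k `<=` V k by case: k => [|k] x //= [].
have sU k : is_subgroup (U k).
  elim: k => [|k IH] /=; first by case: (VP 0).
  by apply: subgroupI => //; case: (VP k.+1).
exists U; split => //.
- elim => [|k IH] /=; first by case: (VP 0).
  by apply: compact_closedI => //; apply: compact_closed => //; case: (VP k.+1).
- elim => [|k IH] /=; first by case: (VP 0).
  by apply: relopenI => //; case: (VP k.+1).
- by move=> k x [].
- move=> W /bB[n Bn BW]; exists n; apply: subset_trans BW.
  by apply: subset_trans (UV n) _; case: (VP n) => _ _ _; exact.
Qed.

(** * Extensions, the residual and the radical *)

Section Closed.
Variables (hG : hausdorff_space G) (U : nat -> set G) (bU : subgroup_basis U).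

Lemma over_extension M N H : is_subgroup H -> closed H -> is_subgroup N ->
  closed N -> normalizes H N -> normalizes H M ->
  elementary_over N H -> elementary_over M N -> elementary_over M H.
Proof.
move=> sH cH sN cN nHN nHM eH eN.
apply: over_lift hG bU (eH) _ _ _ _ _ _ _ _ => //.
by rewrite (_ : N `&` H = N) //; apply/setIidPl; exact: over_ge eH.
Qed.

Definition coelementary H := [set A | [/\ is_subgroup A, closed A,
  normalizes H A & elementary_over A H]].

(** [H / (A ∩ B)] is an extension of [H / A] by [A / (A ∩ B)], and the latter maps injectively to
    the elementary group [H / B]. *)
Lemma coelementaryI H A B : is_subgroup H -> closed H ->
  coelementary H A -> coelementary H B -> coelementary H (A `&` B).
Proof.
move=> sH cH [sA cA nA eA] [sB cB nB eB]; have AH := over_ge eA.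
have nAB : normalizes H (A `&` B) by exact: normalizesI.
split => //; [exact: subgroupI|exact: closedI|].
apply: over_extension (nA) (nAB) (eA) _ => //.
apply: over_lift hG bU (eB) _ _ _ _ _ (AH) _ _ => //.
  exact: normalizes_sub nAB.
by rewrite setIC; apply: over_refl; exact: subgroupI.
Qed.

(** For each basic open set, [A n] is a coelementary subgroup missing it whenever there is one. A
    point outside some coelementary subgroup has a basic neighbourhood missing it, so the countably
    many [A n] already have the least intersection. Their finite intersections [L k] form a
    decreasing coelementary sequence. *)
Lemma exists_residual H : @second_countable G -> is_subgroup H -> closed H ->
  exists2 R, coelementary H R & forall A, coelementary H A -> R `<=` A.
Proof.
move=> /second_countable_enum[B [oB bB]] sH cH.
have eH : coelementary H H.
  by split => //; [exact: normalizes_self|exact: over_refl].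
have /choice[A AP] n : exists A, coelementary H A /\
    forall A', coelementary H A' -> B n `&` A' = set0 -> B n `&` A = set0.
  have [[A eA AB]|nA] :=
      pselect (exists2 A, coelementary H A & B n `&` A = set0).
    by exists A.
  by exists H; split => // A eA AB; case: nA; exists A.
pose L := fix L k := if k is k'.+1 then L k' `&` A k'.+1 else A 0.
have LA k : L k `<=` A k by case: k => [|k] x //= [].
have eL k : coelementary H (L k).
  elim: k => [|k IH] /=; first by case: (AP 0).
  by apply: coelementaryI => //; case: (AP k.+1).
have dL k : L k.+1 `<=` L k by move=> x [].
have sL k : is_subgroup (L k) by case: (eL k).
have cL k : closed (L k) by case: (eL k).
have nL k : normalizes H (L k) by case: (eL k).
have LH k : L k `<=` H by case: (eL k) => _ _ _ /over_ge.
pose R := \bigcap_k L k.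
have RL k : R `<=` L k by move=> x /(_ k Logic.I).
have sR : is_subgroup R.
  split.
  - by move=> k _; exact: sub1.
  - by move=> x y Rx Ry k _; apply: subM => //; exact: RL.
  - by move=> x Rx k _; apply: subV => //; exact: RL.
have nR : normalizes H R.
  by move=> x h Rx Hh k _; apply: nL => //; exact: RL.
have RH : R `<=` H by exact: subset_trans (RL 0) (LH 0).
have cR : closed R by exact: closed_bigI.
exists R; last first.
  move=> A' eA' x Rx; apply: contrapT => nA'x.
  have [_ clA' _ _] := eA'.
  have nW : nbhs x (~` A').
    by apply: open_nbhs_nbhs; split => //; exact: closed_openC.
  have [n Bnx BnA'] := bB _ _ nW.
  have : (B n `&` A n) x by split => //; apply: LA; exact: RL.
  rewrite (proj2 (AP n) _ eA') // -subset0 => z [Bz Az].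
  exact: BnA' Bz Az.
split => //.
have [sU cU oU _ _] := bU.
pose W := U 0 `&` H.
have WH : W `<=` H by move=> x [].
have sW : is_subgroup W by exact: subgroupI.
have cW : compact W by exact: compact_closedI.
have oW : relopen W H by have := relopenII H (oU 0); rewrite setTI.
have [|Kj [sKj dKj oKj KE DKj]] :=
  over_ext_chain (L := L) sH sW WH cW oW sR RH nR sL cL dL RL nL.
  by move=> x [].
have KH j : Kj j `<=` H by rewrite KE => x Kx; exists j.
apply: over_union (KE) _ => // j.
have [DK nD] := DKj j; have [_ _ _ eLj] := eL j.
(* [Kj j] maps to the elementary group [H / L j]. The kernel [L j ∩ Kj j] has the open normal
   subgroup [R (W ∩ L j)], which is compact modulo [R]. *)
apply: over_lift hG bU (eLj) _ _ _ _ _ _ _ _ => //.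
- exact: relopen_closed (oKj j).
- exact: normalizes_sub nR.
- apply: (@over_ext _ _ (mulset R (W `&` L j))).
  + exact: subgroupI.
  + by rewrite subsetI; split => //; exact: mulset_sub.
  + by apply: normalizes_sub nD => x [].
  + apply: mulset_relopen; first exact: sub1.
    have := relopenII (L j) oW; rewrite (setIidr (LH j)) => oWL.
    by apply: relopen_sub oWL _ => x [].
  + apply: (over_compact (C := W `&` L j)) => //.
    * apply: mulset_subgroup => //; first exact: subgroupI.
      by apply: normalizes_sub nR => x [/WH].
    * apply: mulset_subl; exact: (sub1 (subgroupI sW (sL j))).
    * exact: compact_closedI.
Qed.

(** The image of [O] modulo [A] inherits every construction step. Openness of [L] in [O] alone does
    not make [A L] open in [A O]; this is why all stages are kept open in one group [T]. *)
Lemma over_quotient M A T O : elementary_over M O -> M `<=` A ->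
  is_subgroup A -> is_subgroup T -> A `<=` T -> O `<=` T -> relopen O T ->
  normalizes T A -> elementary_over A (mulset A O).
Proof.
move=> eO MA sA sT AT + + nA; elim: eO => {O}.
- move=> O C sO MO cC OMC OT oO; apply: (over_compact (C := C)) => //.
  + by apply: mulset_subgroup => //; exact: normalizes_sub nA.
  + by apply: mulset_subl; exact: sub1.
  + move=> _ [a [o [Aa /OMC[m [c [/MA Am Cc ->]]] ->]]].
    by exists (a * m), c; rewrite mulgA; split => //; exact: subM.
- move=> L O sO LO nL oL eL IH OT oO.
  have sL := over_subgroup eL.
  have LT : L `<=` T by exact: subset_trans OT.
  have oLT : relopen L T by exact: relopen_trans oO.
  have sAL : is_subgroup (mulset A L).
    by apply: mulset_subgroup => //; exact: normalizes_sub nA.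
  apply: (@over_ext _ _ (mulset A L)).
  + by apply: mulset_subgroup => //; exact: normalizes_sub nA.
  + exact: subset_mulset.
  + apply: normalizes_mulset => //.
      apply: normalizes_sub (normalizes_self sAL).
      by apply: mulset_subl; exact: sub1.
    by apply: mulset_normalizes => //; exact: normalizes_sub nA.
  + apply: mulset_relopen; first exact: sub1.
    by apply: relopen_sub oLT _; exact: mulset_sub.
  + exact: IH.
- move=> O H sH dO oO HO eO IH HT oH.
  have OT i : O i `<=` T.
    by apply: subset_trans HT; rewrite HO => x Ox; exists i.
  have oOT i : relopen (O i) T by exact: relopen_trans oH.
  apply: (@over_union _ _ (fun i => mulset A (O i))).
  + by apply: mulset_subgroup => //; exact: normalizes_sub nA.
  + by move=> i; exact: subset_mulset.
  + move=> i; apply: mulset_relopen; first exact: sub1.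
    by apply: relopen_sub (oOT i) _; exact: mulset_sub.
  + apply/seteqP; split=> [_ [a [h [Aa Hh ->]]]|x [i _ [a [o [Aa Oo ->]]]]].
      by move: Hh; rewrite HO => -[i _ Oh]; exists i => //; exists a, h.
    by exists a, o; split => //; rewrite HO; exists i.
  + by move=> i; exact: IH.
Qed.

Definition normal_elementary Q := [set A | [/\ is_subgroup A, closed A,
  A `<=` Q, normalizes Q A & elementary_over [set 1] A]].

Lemma mulsetA A B C : mulset (mulset A B) C = mulset A (mulset B C).
Proof.
apply/seteqP; split=> x.
  move=> [_ [c [[a [b [Aa Bb ->]]] Cc ->]]]; exists a, (b * c).
  by split => //; [exists b, c|rewrite mulgA].
move=> [a [_ [Aa [b [c [Bb Cc ->]]] ->]]]; exists (a * b), c.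
by split => //; [exists a, b|rewrite mulgA].
Qed.

Lemma normalizes_set1 H : normalizes H [set 1].
Proof. by move=> x h ->; rewrite conj1g. Qed.

(** Dual to the residual: [A n] meets the basic set [B n] whenever some member of
    [normal_elementary Q] does, so every member lies in the closure [R] of the union of the finite
    products [D k]. *)
Lemma exists_radical Q : @second_countable G -> is_subgroup Q -> closed Q ->
  exists2 R, normal_elementary Q R &
    forall A, normal_elementary Q A -> A `<=` R.
Proof.
move=> /second_countable_enum[B [oB bB]] sQ cQ.
have e1 : normal_elementary Q [set 1].
  split.
  - exact: subgroup_set1.
  - exact/accessible_closed_set1/hausdorff_accessible.
  - by move=> x ->; exact: sub1.
  - exact: normalizes_set1.
  - exact/over_refl/subgroup_set1.
have /choice[A AP] n : exists A, normal_elementary Q A /\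
    forall A', normal_elementary Q A' -> A' `&` B n !=set0 ->
      A `&` B n !=set0.
  have [[A eA AB]|nA] :=
      pselect (exists2 A, normal_elementary Q A & A `&` B n !=set0).
    by exists A.
  by exists [set 1]; split => // A eA AB; case: nA; exists A.
have eA n : normal_elementary Q (A n) by have [] := AP n.
have sA n : is_subgroup (A n) by have [] := eA n.
have AQ n : A n `<=` Q by have [] := eA n.
have nA n : normalizes Q (A n) by have [] := eA n.
pose D := fix D k := if k is k'.+1 then mulset (A k') (D k') else [set 1].
have DP k : [/\ is_subgroup (D k), D k `<=` Q & normalizes Q (D k)].
  elim: k => [|k [sD DQ nD]] /=; first by case: e1.
  split; last exact: mulset_normalizes.
    apply: mulset_subgroup => //; exact: normalizes_sub (nA k).
  exact: mulset_sub.
have sD k : is_subgroup (D k) by have [] := DP k.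
have dD k : D k `<=` D k.+1 by apply: mulset_subr; exact: sub1.
pose Du := \bigcup_k D k; pose R := closure Du.
have sDu : is_subgroup Du.
  split; first by exists 0.
  - move=> x y [i _ Dx] [j _ Dy]; exists (maxn i j) => //; apply: subM => //.
      exact: increasing_subset dD (leq_maxl i j) _ Dx.
    exact: increasing_subset dD (leq_maxr i j) _ Dy.
  - by move=> x [i _ Dx]; exists i => //; exact: subV.
have nDu : normalizes Q Du.
  by move=> x h [i _ Dx] Qh; exists i => //; have [_ _] := DP i; apply.
have sR : is_subgroup R by exact: closure_subgroup.
have cR : closed R by exact: closed_closure.
have nR : normalizes Q R by exact: closure_normalized.
have RQ : R `<=` Q.
  move=> x Rx; apply: cQ => W /Rx [y [[k _ Dy] Wy]].
  by exists y; split => //; have [_ DQ _] := DP k; exact: DQ.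
have DR k : D k `<=` R.
  by move=> x Dx; apply: subset_closure; exists k.
have AR n : A n `<=` R.
  apply: subset_trans (DR n.+1); apply: mulset_subl; exact: sub1.
exists R; last first.
  move=> A' eA' x A'x W /bB[n Bnx BW].
  have [|z [Az Bz]] := proj2 (AP n) _ eA'; first by exists x.
  exists z; split; last exact: BW.
  by exists n.+1 => //; apply: mulset_subl Az; exact: sub1.
split => //.
have [sU cU oU _ _] := bU.
pose W := U 0 `&` R.
have WR : W `<=` R by move=> x [].
have sW : is_subgroup W by exact: subgroupI.
have cW : compact W by exact: compact_closedI.
have oW : relopen W R by have := relopenII R (oU 0); rewrite setTI.
have DWR k : mulset (D k) W `<=` R by exact: mulset_sub.
have oDW k : relopen (mulset (D k) W) R.
  by apply: mulset_relopen => //; exact: sub1.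
have sDW k : is_subgroup (mulset (D k) W).
  apply: mulset_subgroup => //; have [_ _] := DP k.
  by apply: normalizes_sub => x [_ /RQ].
(* The union of the [D k] is dense in [R] and [W] is open in [R], so the open subgroups [D k W]
   exhaust [R]. *)
apply: (@over_union _ _ (fun k => mulset (D k) W)) => //.
- by move=> k; exact: subset_mulset.
- apply/seteqP; split=> [x Rx|x [k _ /DWR] //].
  have [d [[k _ Dd] /(_ Logic.I) Ud]] := Rx _ (near_divr x (oU 0)).
  exists k => //; exists d, (d^-1 * x); split => //; last by rewrite mulVKg.
  by split => //; apply: (subM sR) => //; apply: (subV sR); exact: DR Dd.
- elim=> [|k IH].
    apply: (over_compact (C := W)) => //.
    by apply: mulset_subl; exact: sub1.
  have := sDW k.+1; have := oDW k.+1; have := DWR k.+1.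
  rewrite /= mulsetA => sub o s.
  have [_ cA _ _ e1A] := eA k.
  (* Since [D k.+1 W = A k (D k W)], this group is an extension of the elementary [A k] by an image
     of [D k W]. *)
  apply: over_extension (e1A) => //.
  + exact: relopen_closed o.
  + by apply: normalizes_sub (nA k); exact: subset_trans RQ.
  + exact: normalizes_set1.
  + apply: (over_quotient (M := [set 1]) (T := R)) => //.
      by move=> x ->; exact: sub1.
    exact: normalizes_sub (nA k).
Qed.

End Closed.

(** * Transport along a topological automorphism [f] with inverse [g] *)

Section Image.
Variables (f g : G -> G).
Hypotheses (fM : {morph f : x y / x * y}) (fK : cancel f g) (gK : cancel g f).
Hypotheses (cf : continuous f) (cg : continuous g).

Lemma imageE H : f @` H = g @^-1` H.
Proof.
apply/seteqP; split=> [_ [x Hx <-]|x Hx] /=; first by rewrite fK.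
by exists (g x) => //; rewrite gK.
Qed.

Let gM : {morph g : x y / x * y}.
Proof. by move=> x y; apply: (can_inj fK); rewrite fM !gK. Qed.

Let g1 : g 1 = 1.
Proof. by apply: (@mulgI G (g 1)); rewrite -gM !mulg1. Qed.

Let gV x : g x^-1 = (g x)^-1.
Proof. by apply: (@mulgI G (g x)); rewrite -gM !mulgV g1. Qed.

Lemma image_subgroup H : is_subgroup H -> is_subgroup (f @` H).
Proof.
move=> sH; rewrite imageE; split=> [|x y|x] /=.
- by rewrite g1; exact: sub1.
- by rewrite gM; exact: subM.
- by rewrite gV; exact: subV.
Qed.

Lemma image_closed H : closed H -> closed (f @` H).
Proof. by move=> cH; rewrite imageE; exact: (closed_comp (fun x _ => @cg x)). Qed.

Lemma image_normalizes H N : normalizes H N -> normalizes (f @` H) (f @` N).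
Proof.
move=> nN; rewrite !imageE => x h /= Nx Hh.
by rewrite /conjg !gM gV; exact: nN.
Qed.

Lemma image_relopen H L : relopen L H -> relopen (f @` L) (f @` H).
Proof.
move=> oL; rewrite !imageE.
have c1 : g @ (1 : G) --> (1 : G) by rewrite -[X in _ --> X]g1; exact: cg.
exact: (c1 (fun z => H z -> L z) oL).
Qed.

Lemma over_image N H : elementary_over N H -> elementary_over (f @` N) (f @` H).
Proof.
elim=> {H}.
- move=> H C sH NH cC HNC; apply: (over_compact (C := f @` C)).
  + exact: image_subgroup.
  + exact: image_subset.
  + by apply: continuous_compact => //; exact: continuous_subspaceT.
  + move=> _ [_ /HNC[n [c [Nn Cc ->]]] <-]; exists (f n), (f c).
    by split; [exists n|exists c|exact: fM].
- move=> L H sH LH nL oL _ eL; apply: over_ext (eL).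
  + exact: image_subgroup.
  + exact: image_subset.
  + exact: image_normalizes.
  + exact: image_relopen.
- move=> O H sH dO oO HO _ eO; apply: (@over_union _ _ (fun i => f @` O i)) => //.
  + exact: image_subgroup.
  + by move=> i; exact: image_subset.
  + by move=> i; exact: image_relopen.
  + by rewrite HO image_bigcup.
Qed.

End Image.

End ResidualRadical.

(** * Comparison with elementary groups *)

(* [p] induces an isomorphism of topological groups from [H / N] to [X]; its
   values outside [H] are irrelevant. *)
Record presents (G X : topGroupType) (H N : set G) (p : G -> X) : Prop :=
  Presents {
    pr_subgroup : is_subgroup H;
    pr_sub : N `<=` H;
    pr_M : forall x y, H x -> H y -> p (x * y) = p x * p y;
    pr_ker : forall x, H x -> p x = 1 <-> N x;
    pr_surj : forall z, exists2 x, H x & p x = z;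
    pr_near : forall W, nbhs (1 : X) W ->
      \forall x \near (1 : G), H x -> W (p x);
    pr_open : forall W, nbhs (1 : G) W -> nbhs (1 : X) (p @` (H `&` W)) }.

Section Presents.
Context {G X : topGroupType} {H N : set G} {p : G -> X}.
Hypothesis pP : presents H N p.
Implicit Types (x y : G) (A B C L M V W : set G) (K : set X).
Let sH := pr_subgroup pP.

Lemma pr_1 : p 1 = 1.
Proof.
apply: (@mulgI X (p 1)).
by rewrite -(pr_M pP) ?mulg1 //; exact: sub1.
Qed.

Lemma pr_V x : H x -> p x^-1 = (p x)^-1.
Proof.
move=> Hx; apply: (@mulgI X (p x)).
by rewrite -(pr_M pP) ?mulgV ?pr_1 //; exact: subV.
Qed.

Lemma pr_J x y : H x -> H y -> p (x ^ y) = p x ^ p y.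
Proof.
move=> Hx Hy; have HVy := subV sH Hy; have Hxy := subM sH Hx Hy.
by rewrite /conjg !(pr_M pP) ?pr_V.
Qed.

Lemma pr_eq x y : H x -> H y -> p x = p y -> N (x^-1 * y).
Proof.
move=> Hx Hy xy; apply/(pr_ker pP); first by apply: subM => //; exact: subV.
by rewrite (pr_M pP) ?pr_V ?xy ?mulVg //; exact: subV.
Qed.

Lemma pr_kernel : is_subgroup N.
Proof.
split.
- by apply/(pr_ker pP); [exact: sub1|exact: pr_1].
- move=> x y Nx Ny; have Hx := pr_sub pP Nx; have Hy := pr_sub pP Ny.
  apply/(pr_ker pP); first exact: subM.
  rewrite (pr_M pP) //; move/(pr_ker pP) : Nx => -> //.
  by move/(pr_ker pP) : Ny => -> //; rewrite mulg1.
- move=> x Nx; have Hx := pr_sub pP Nx.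
  apply/(pr_ker pP); first exact: subV.
  by rewrite pr_V //; move/(pr_ker pP) : Nx => -> //; rewrite invg1.
Qed.

Lemma pr_normal : normalizes H N.
Proof.
move=> x h Nx Hh; have Hx := pr_sub pP Nx.
apply/(pr_ker pP); first exact: subJ.
by rewrite pr_J //; move/(pr_ker pP) : Nx => -> //; rewrite conj1g.
Qed.

Lemma pr_cvg x (W' : set X) : H x -> nbhs (p x) W' ->
  \forall y \near x, H y -> W' (p y).
Proof.
move=> Hx /near_mull /(pr_near pP) /(near_divl x).
apply: filterS => y; rewrite /= => + Hy.
have Hxy : H (x^-1 * y) by apply: subM => //; exact: subV.
by move=> /(_ Hxy); rewrite -(pr_M pP) // mulVKg.
Qed.

Lemma pr_compact C : compact C -> C `<=` H -> compact (p @` C).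
Proof.
move=> cC CH; apply: continuous_compact => //.
apply/subspace_continuousP => x Cx W' /(pr_cvg (CH _ Cx)) nW.
apply: (@filterS _ (nbhs x) _ _ _ _ nW) => y HW Cy.
by apply: HW; exact: CH.
Qed.

Lemma pr_preimage_subgroup K : is_subgroup K -> is_subgroup (H `&` p @^-1` K).
Proof.
move=> sK; split.
- by split; [exact: sub1|rewrite /preimage /= pr_1; exact: sub1].
- move=> x y [Hx Kx] [Hy Ky]; split; first exact: subM.
  by rewrite /preimage /= (pr_M pP) //; exact: subM.
- move=> x [Hx Kx]; split; first exact: subV.
  by rewrite /preimage /= pr_V //; exact: subV.
Qed.

Lemma pr_preimage_normalizes K K' : normalizes K K' ->
  normalizes (H `&` p @^-1` K) (H `&` p @^-1` K').
Proof.
move=> nK x h [Hx Kx] [Hh Kh]; split; first exact: subJ.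
by rewrite /preimage /= pr_J //; exact: nK.
Qed.

Lemma pr_preimage_closed K : closed H -> closed K -> closed (H `&` p @^-1` K).
Proof.
move=> cH cK x clx.
have Hx : H x by apply: cH => W /clx [y [[Hy _] Wy]]; exists y.
split => //; apply: cK => W' /(pr_cvg Hx) /clx [y [[Hy Ky] HW]].
by exists (p y); split => //; exact: HW.
Qed.

Lemma pr_image_subgroup L : is_subgroup L -> L `<=` H -> is_subgroup (p @` L).
Proof.
move=> sL LH; split.
- by exists 1; [exact: sub1|exact: pr_1].
- move=> _ _ [x Lx <-] [y Ly <-]; exists (x * y); first exact: subM.
  by rewrite (pr_M pP) //; exact: LH.
- move=> _ [x Lx <-]; exists x^-1; first exact: subV.
  by rewrite pr_V //; exact: LH.
Qed.

Lemma pr_image_relopen L : relopen L H -> relopen (p @` L) setT.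
Proof.
move=> oL; have := pr_open pP oL; rewrite /relopen.
by apply: filterS => _ [x [Hx Lx] <-] _; exists x => //; exact: Lx.
Qed.

Lemma pr_pullback (U : nat -> set G) K : subgroup_basis U ->
  elementary_over [set 1] K -> elementary_over N (H `&` p @^-1` K).
Proof.
move=> [sU cU oU _ _]; elim=> {K}.
- move=> K C sK _ cC KC.
  have NHK : N `<=` H `&` p @^-1` K.
    move=> x Nx; have Hx := pr_sub pP Nx; split => //.
    by rewrite /preimage /=; move/(pr_ker pP) : Nx => -> //; exact: sub1.
  (* A property holds near [F] when it holds for all sets containing some compact set. Each [c] in
     [C] has a neighbourhood covered by the image of a compact translate [x U 0]; the near-covering
     form of compactness then provides one compact [D] for all of [C]. *)
  pose F := filter_from (@compact G) (fun D => [set D' | D `<=` D']).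
  have FF : Filter F.
    apply: filter_from_filter; first by exists set0; exact: compact0.
    move=> D1 D2 c1 c2; exists (D1 `|` D2); first exact: compactU.
    by move=> D; rewrite /= subUset => -[].
  have [D cD] : \forall D \near F,
      C `<=` (fun c => forall x, H x -> p x = c -> mulset N D x).
    move/compact_near_coveringP : cC; apply => c _.
    have [x Hx <-] := pr_surj pP c.
    have nU : nbhs 1 (U 0).
      by have := oU 0; rewrite /relopen; apply: filterS => y; exact.
    exists ((fun z => (p @` (H `&` U 0)) ((p x)^-1 * z)),
      [set D | mulset [set x] (U 0) `<=` D]) => /=.
      split; first exact: (near_divl (p x) (pr_open pP nU)).
      exists (mulset [set x] (U 0)) => //.
      by apply: mulset_compact => //; exact: compact_set1.
    move=> [z D] /= [[u [Hu Uu] puE] xUD] y Hy yE.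
    have Nxy : N ((x * u)^-1 * y).
      apply: pr_eq => //; first exact: subM.
      by rewrite (pr_M pP) // puE yE mulVKg.
    exists (((x * u)^-1 * y) ^ (x * u)^-1), (x * u); split.
    + by apply: pr_normal => //; apply: (subV sH); exact: subM.
    + by apply: xUD; exists x, u.
    + by rewrite conjgE !gnorm.
  move=> /(_ D (@subset_refl _ D)) CD; apply: (over_compact (C := D)) => //.
    exact: pr_preimage_subgroup.
  move=> x [Hx /KC[_ [c [-> Cc]]]]; rewrite mul1g => pxc.
  exact: CD Cc _ Hx pxc.
- move=> L K sK LK nL oL _ eL; apply: over_ext (eL).
  + exact: pr_preimage_subgroup.
  + by move=> x [Hx Lx]; split => //; exact: LK.
  + exact: pr_preimage_normalizes.
  + have := pr_near pP oL; rewrite /relopen.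
    by apply: filterS => x HKL [Hx Kx]; split => //; exact: HKL.
- move=> O K sK dO oO KO _ eO.
  apply: (@over_union _ _ (fun i => H `&` p @^-1` (O i))) => //.
  + exact: pr_preimage_subgroup.
  + by move=> i x [Hx Ox]; split => //; exact: dO.
  + move=> i; have := pr_near pP (oO i); rewrite /relopen.
    by apply: filterS => x HKL [Hx Kx]; split => //; exact: HKL.
  + by rewrite KO preimage_bigcup setI_bigcupr.
Qed.

End Presents.

(** * Subquotients presented inside one ambient group *)

Lemma presents_id (G : topGroupType) :
  @presents G G setT [set 1] idfun.
Proof.
split => //.
- by move=> z; exists z.
- by move=> W; apply: filterS.
- by move=> W; apply: filterS => x Wx; exists x.
Qed.

Lemma subgroup_is_subgroup (G : topGroupType) (K : subgroup G) :
  is_subgroup K.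
Proof.
have cK := subgroupP K; split.
- by apply/set_mem; case: cK.
- move=> x y /mem_set Kx /mem_set Ky; apply/set_mem.
  exact: (group_closedM cK).
- by move=> x /mem_set Kx; apply/set_mem; exact: (group_closedV cK).
Qed.

Lemma nbhs_subgroup (G : topGroupType) (K : subgroup G) (z : subgroup_type K)
    (W : set (subgroup_type K)) :
  nbhs z W <-> exists2 V, nbhs (val z) V & val @^-1` V `<=` W.
Proof.
split.
  rewrite nbhsE => -[_ [[V oV <-] Vz] VW]; exists V => //.
  by apply: open_nbhs_nbhs; split.
move=> [V nV VW]; apply: filterS VW _.
have /continuousP cval : continuous (val : subgroup_type K -> G).
  exact: initial_continuous.
move: nV; rewrite nbhsE => -[O [oO Oz] OV].
apply: filterS (open_nbhs_nbhs (conj (cval _ oO) Oz)) => y; exact: OV.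
Qed.

(** [insubd] turns [p x] into an element of the type of [K]; its default 1 is taken only outside
    [L]. *)
Lemma presents_subgroup (G X : topGroupType) (H N L : set G) (p : G -> X)
    (K : subgroup X) : presents H N p -> L = H `&` p @^-1` K ->
  presents L N (fun x => insubd (1 : subgroup_type K) (p x)).
Proof.
move=> pP LE; have sK := subgroup_is_subgroup K; rewrite {}LE.
have vE x : subgroup_set K (p x) ->
    val (insubd (1 : subgroup_type K) (p x)) = p x.
  by move=> Kx; rewrite val_insubd; case: ifP => // /negP[]; exact/mem_set.
split.
- exact: (pr_preimage_subgroup pP sK).
- move=> x Nx; have Hx := pr_sub pP Nx; split => //.
  by rewrite /preimage /=; move/(pr_ker pP) : Nx => -> //; exact: sub1.
- move=> x y [Hx Kx] [Hy Ky]; apply: val_inj.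
  rewrite /= !vE // (pr_M pP) //; exact: subM.
- move=> x [Hx Kx]; rewrite -(pr_ker pP) //; split.
    by move=> /(congr1 val); rewrite vE.
  by move=> p1; apply: val_inj; rewrite vE.
- move=> z; have [x Hx xz] := pr_surj pP (val z).
  have Kx : subgroup_set K (p x) by rewrite xz; apply/set_mem; exact: valP.
  by exists x; [split|apply: val_inj; rewrite vE].
- move=> W /nbhs_subgroup[V /(pr_near pP) nV VW].
  apply: filterS nV => x HV [Hx Kx]; apply: VW.
  by rewrite /preimage /= vE //; exact: HV.
- move=> W nW; apply/nbhs_subgroup; exists (p @` (H `&` W)).
    exact: (pr_open pP nW).
  move=> z [x [Hx Wx] xz].
  have Kx : subgroup_set K (p x) by rewrite xz; apply/set_mem; exact: valP.
  by exists x; [split|apply: val_inj; rewrite vE].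
Qed.

Lemma presents_quotient (G X : topGroupType) (H N L : set G) (p : G -> X)
    (K : normal_subgroup X) : presents H N p -> L = H `&` p @^-1` K ->
  presents H L (fun x => \pi_(quotient_group K)%qT (p x)).
Proof.
move=> pP ->; have sK := subgroup_is_subgroup K.
split.
- exact: pr_subgroup pP.
- by move=> x [].
- by move=> x y Hx Hy; rewrite (pr_M pP) // quotient_piM.
- move=> x Hx; split.
    move=> /esym /eqquotP; rewrite /= /coset_rel invg1 mul1g => /set_mem Kx.
    by split.
  move=> [_ Kx]; apply/esym/eqquotP; rewrite /= /coset_rel invg1 mul1g.
  exact/mem_set.
- move=> z; have [x Hx xz] := pr_surj pP (repr z).
  by exists x => //; rewrite xz reprK.
- by move=> W nW; exact: (pr_near pP (@quotient_pi_continuous X K 1 W nW)).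
- move=> W /(pr_open pP); rewrite nbhsE => -[V [oV V1] VW].
  rewrite nbhsE; exists (\pi_(quotient_group K)%qT @` V).
    by split; [exact: quotient_pi_open|exists 1].
  by move=> _ [_ /VW[x xHW <-] <-]; exists x.
Qed.

Lemma is_subgroup_closed (G : topGroupType) (H : set G) :
  is_subgroup H -> group_closed (mem H).
Proof.
move=> sH; split=> [|x y]; first exact/mem_set/(sub1 sH).
by move=> /set_mem Hx /set_mem Hy; apply/mem_set; exact: subMV.
Qed.

Definition to_subgroup (G : topGroupType) (H : set G) (sH : is_subgroup H) :
  subgroup G := Subgroup (is_subgroup_closed sH).

(** The images [P k] of the [H ∩ U k] are compact open subgroups of [X]. Their cosets are clopen
    and, as [N] is closed, separate points; a countable basis of [G] maps to one of [X]. *)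
Lemma presents_tdlcsc (G X : topGroupType) (H N : set G) (p : G -> X) :
  tdlcsc G -> closed H -> closed N -> presents H N p -> tdlcsc X.
Proof.
move=> tG cH cN pP; have [U [sU cU oU dU bU]] := exists_subgroup_basis tG.
have sH := pr_subgroup pP; have [hG _ _ [B cB [oB bB]]] := tG.
pose P k := p @` (H `&` U k).
have sP k : is_subgroup (P k).
  by apply: (pr_image_subgroup pP); [exact: subgroupI|move=> x []].
have oP k : relopen (P k) setT.
  apply: (pr_image_relopen pP); apply: relopenI; first exact: relopenxx.
  exact: relopen_sub (oU k) _.
have cP k : closed (P k).
  exact: relopen_closed (sP k) (@subsetT _ _) closedT (IsSubgroup _ _ _) (oP k).
have PX k (x : X) : clopen [set t | P k (x^-1 * t)].
  split.
    apply: open_comp; last exact: open_subgroup.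
    by move=> t _; exact: mull_continuous.
  by apply: closed_comp; [move=> t _; exact: mull_continuous|].
have zd (x y : X) : x != y ->
    exists S : set X, [/\ clopen S, S x & ~ S y].
  move=> /eqP xy; have [h Hh hE] := pr_surj pP (x^-1 * y).
  have nNh : ~ N h.
    move=> /(pr_ker pP Hh); rewrite hE => /(congr1 (mul x)).
    by rewrite mulVKg mulg1 => /esym.
  have nN : nbhs h (~` N).
    by apply: open_nbhs_nbhs; split => //; exact: closed_openC.
  have [k Uk] := bU _ (near_mulr nN).
  exists [set t | P k (x^-1 * t)]; split => //=.
    by rewrite mulVg; exact: sub1.
  move=> [v [Hv Uv]]; rewrite -hE => /(pr_eq pP Hv Hh).
  by apply: Uk; exact: subV.
split.
- rewrite open_hausdorff => x y /zd[S [[oS cS] Sx Sy]].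
  exists (S, ~` S) => /=; first by split; exact/mem_set.
  split => //; first exact: closed_openC.
  by apply/eqP; rewrite setICr.
- exact: zero_dimension_totally_disconnected.
- move=> x _; exists [set t | P 0 (x^-1 * t)].
    suff : nbhs x [set t | P 0 (x^-1 * t)] by exact: filterS.
    apply: open_nbhs_nbhs; split; first by case: (PX 0 x).
    by rewrite /= mulVg; exact: sub1.
  split; last by case: (PX 0 x).
  rewrite (_ : [set t | _] = mul x @` P 0).
    apply: continuous_compact.
      exact/continuous_subspaceT/mull_continuous.
    apply: (pr_compact pP); last by move=> y [].
    by rewrite setIC; exact: compact_closedI.
  apply/seteqP; split=> [t Pt|_ [t Pt <-]] /=; last by rewrite mulKg.
  by exists (x^-1 * t) => //; rewrite mulVKg.
- exists [set p @` (H `&` b) | b in B].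
    by apply: sub_countable cB; exact: card_image_le.
  split.
    move=> _ [b Bb <-]; apply: open_near => _ [y [Hy by_] <-].
    have nb : nbhs y b by apply: open_nbhs_nbhs; split => //; exact: oB.
    apply: filterS (pr_open pP (near_mull nb)) => _ [t [Ht byt] <-].
    by exists (y * t); [split => //; exact: subM|exact: (pr_M pP)].
  move=> x W; have [h Hh <-] := pr_surj pP x.
  move=> /(pr_cvg pP Hh) /bB[b [Bb bh] bW].
  exists (p @` (H `&` b)); first by split; [exists b|exists h].
  by move=> _ [y [Hy by_] <-]; exact: bW.
Qed.

Lemma discrete_quotient (X : topGroupType) (K : normal_subgroup X) :
  relopen K setT -> discrete_space (quotient_group K).
Proof.
move=> oK; have sK := subgroup_is_subgroup K.
apply/funext => q; apply/seteqP; split=> A.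
  by move=> /nbhs_singleton Aq; apply/principal_filterP.
move=> /principal_filterP Aq.
suff o1 : open [set q].
  by rewrite nbhsE; exists [set q]; [split|move=> _ ->].
rewrite (_ : [set q] = \pi_(quotient_group K)%qT @`
    [set t | subgroup_set K ((repr q)^-1 * t)]).
  apply: quotient_pi_open; apply: open_comp; last exact: open_subgroup.
  by move=> t _; exact: mull_continuous.
apply/seteqP; split=> [_ ->|_ [t Kt <-]].
  by exists (repr q); [rewrite /= mulVg; exact: sub1|exact: reprK].
by apply: (etrans _ (reprK q)); apply/esym/eqquotP; exact/mem_set.
Qed.

(** The induction runs over all [X] and [p], since each stage of [H] presents its own image in [X].
    Stages are open in [H], hence closed, and so their images are again t.d.l.c.s.c. *)
Lemma over_elementary (G X : topGroupType) (H N : set G) (p : G -> X) :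
  tdlcsc G -> closed N -> closed H -> presents H N p ->
  elementary_over N H -> elementary X.
Proof.
move=> tG cN cH pP eH; elim: eH X p pP cH => {H}.
- move=> H C sH NH cC HNC X p pP cH.
  have [hX tdX lcX scX] := presents_tdlcsc tG cH cN pP.
  apply: elementary_profinite => //; split => //.
  rewrite (_ : [set: X] = p @` (C `&` H)).
    by apply: (pr_compact pP); [exact: compact_closedI|move=> x []].
  apply/seteqP; split => // z _; have [x Hx <-] := pr_surj pP z.
  have [n [c [Nn Cc xE]]] := HNC _ Hx; have Hn := NH _ Nn.
  have Hc : H c.
    by rewrite -[c](mulKg n) -xE; apply: subM => //; exact: subV.
  exists c => //; rewrite xE (pr_M pP) //.
  by rewrite ((pr_ker pP Hn).2 Nn) mul1g.
- move=> L H sH LH nL oL eL IH X p pP cH.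
  have sL := over_subgroup eL.
  have sK := pr_image_subgroup pP sL LH.
  have nK : normal (to_subgroup sK).
    move=> _ z [x Lx <-]; have [h Hh <-] := pr_surj pP z.
    exists (x ^ h); first exact: nL.
    by rewrite (pr_J pP) //; exact: LH.
  have oK := pr_image_relopen pP oL.
  apply: (@elementary_extension X (NormalSubgroup nK)).
  + exact: presents_tdlcsc pP.
  + exact: relopen_closed (sK) (@subsetT _ _) closedT (IsSubgroup _ _ _) oK.
  + apply: (IH _ _ (presents_subgroup (K := to_subgroup sK) pP _)).
      apply/seteqP; split=> [x Lx|x [Hx [l Ll lx]]].
        by split; [exact: LH|exists x].
      rewrite -[x](mulVKg l); apply: (subM sL) => //.
      apply: (over_ge eL); apply: (pr_eq pP) => //; exact: LH.
    exact: relopen_closed oL.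
  + by right; exact: discrete_quotient.
- move=> O H sH dO oO HO eO IH X p pP cH.
  have OH i : O i `<=` H by rewrite HO => x Ox; exists i.
  have sO i := over_subgroup (eO i).
  have sK i := pr_image_subgroup pP (sO i) (OH i).
  apply: (@elementary_union X (fun i => to_subgroup (sK i))).
  + exact: presents_tdlcsc pP.
  + move=> i; exact: (open_subgroup (sK i) (pr_image_relopen pP (oO i))).
  + by move=> i; exact: image_subset.
  + apply/seteqP; split => // z _; have [x Hx <-] := pr_surj pP z.
    by move: Hx; rewrite HO => -[i _ Ox]; exists i => //; exists x.
  + move=> i.
    apply: (IH i _ _ (presents_subgroup (K := to_subgroup (sK i)) pP _)).
      apply/seteqP; split=> [x Ox|x [Hx [l Ol lx]]].
        by split; [exact: (OH i)|exists x].
      rewrite -[x](mulVKg l); apply: (subM (sO i)) => //.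
      apply: (over_ge (eO i)); apply: (pr_eq pP) => //; exact: (OH i).
    exact: relopen_closed (oO i).
Qed.

Lemma subgroup_setT (G : topGroupType) : is_subgroup [set: G].
Proof. by []. Qed.

Lemma normalizes_setT (G : topGroupType) (K : normal_subgroup G) :
  normalizes setT K.
Proof. by move=> x h Kx _; exact: (@normal_subgroupP _ K). Qed.

Lemma over_profinite (G : topGroupType) : profinite G ->
  elementary_over [set (1 : G)] setT.
Proof.
move=> [cG _ _]; apply: (over_compact (C := setT)) => //.
exact: mulset_subr.
Qed.

Lemma over_discrete (G : topGroupType) : discrete_space G ->
  elementary_over [set (1 : G)] setT.
Proof.
move=> dG; apply: (@over_ext _ _ [set 1]) => //.
- exact: normalizes_set1.
- have n1 : nbhs (1 : G) [set 1].
    suff: principal_filter (1 : G) [set 1] by rewrite -dG.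
    exact/principal_filterP.
  by move: n1; rewrite /relopen; apply: filterS.
- exact/over_refl/subgroup_set1.
Qed.

(** Subgroups and quotients are pulled back to the ambient group by [pr_pullback]. Profinite
    quotients, which have no constructor in [elementary_over], are absorbed by [over_extension]. *)
Lemma elementary_over_setT (X : topGroupType) : elementary X ->
  elementary_over [set (1 : X)] setT.
Proof.
elim=> {X}.
- by move=> G pG _; exact: over_profinite.
- by move=> G dG _; exact: over_discrete.
- move=> G H tG cH _ IH qH; have [hG _ _ _] := tG.
  have [U bU] := exists_subgroup_basis tG.
  have sH := subgroup_is_subgroup H.
  have eH : elementary_over [set 1] (subgroup_set H).
    have HE : subgroup_set H = setT `&` idfun @^-1` H by rewrite setTI.
    have := pr_pullback (presents_subgroup (presents_id G) HE) bU IH.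
    by rewrite setIT.
  have eQ : elementary_over H [set: G].
    have HE : subgroup_set H = setT `&` idfun @^-1` H by rewrite setTI.
    have := pr_pullback (presents_quotient (presents_id G) HE) bU.
    move=> /(_ setT); rewrite setIT; apply.
    by case: qH; [exact: over_profinite|exact: over_discrete].
  apply: (over_extension hG bU (subgroup_setT G) closedT sH cH _ _ eQ eH).
    exact: normalizes_setT.
  exact: normalizes_set1.
- move=> G O tG oO dO OE _ IH.
  have [U bU] := exists_subgroup_basis tG.
  apply: (@over_union _ _ (fun i => subgroup_set (O i))) => //.
    move=> i; have sO := subgroup_is_subgroup (O i).
    have : nbhs 1 (subgroup_set (O i)).
      by apply: open_nbhs_nbhs; split => //; exact: sub1.
    by rewrite /relopen; apply: filterS.
  move=> i.
  have HE : subgroup_set (O i) = setT `&` idfun @^-1` (O i) by rewrite setTI.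
  have := pr_pullback (presents_subgroup (presents_id G) HE) bU (IH i).
  by rewrite setIT.
Qed.

Lemma elementary_presented (G X : topGroupType) (U : nat -> set G)
    (H N : set G) (p : G -> X) :
  subgroup_basis U -> presents H N p -> elementary X -> elementary_over N H.
Proof.
move=> bU pP /elementary_over_setT /(pr_pullback pP bU).
by rewrite preimage_setT setIT.
Qed.

(** * Characteristic subgroups *)

Section Characteristic.
Context {G : topGroupType}.
Implicit Types (f : G -> G) (A H Q R : set G).

Lemma automorphism_inverse f : topological_automorphism f ->
  exists g, [/\ topological_automorphism g, cancel f g & cancel g f].
Proof.
move=> [fM cf [g [fK gK cg]]]; exists g; split => //; split => //.
  by move=> x y; apply: (can_inj fK); rewrite fM !gK.
by exists f.
Qed.

(** An extremal [H] is comparable with its images under [f] and under the inverse of [f]; the two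
    inclusions give equality. *)
Lemma automorphism_fixed (P : set G -> Prop) H :
    (forall f, topological_automorphism f -> P (f @` H)) ->
    (forall A, P A -> H `<=` A) \/ (forall A, P A -> A `<=` H) ->
  characteristic H.
Proof.
move=> PH mH f af; have [g [ag fK gK]] := automorphism_inverse af.
case: mH => mH; apply/seteqP; split.
- move=> _ [x Hx <-]; have [y Hy <-] := mH _ (PH _ ag) _ Hx.
  by rewrite gK.
- by apply: mH; exact: PH.
- by apply: mH; exact: PH.
- by move=> x Hx; exists (g x) => //; apply: (mH _ (PH _ ag)); exists x.
Qed.

Lemma coelementary_image f H A : topological_automorphism f -> f @` H = H ->
  coelementary H A -> coelementary H (f @` A).
Proof.
move=> [fM cf [g [fK gK cg]]] fH [sA cA nA eA]; split.
- exact: image_subgroup sA.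
- exact: image_closed cA.
- by rewrite -fH; exact: image_normalizes nA.
- by rewrite -fH; exact: over_image eA.
Qed.

Lemma normal_elementary_image f H A : topological_automorphism f ->
  f @` H = H -> normal_elementary H A -> normal_elementary H (f @` A).
Proof.
move=> [fM cf [g [fK gK cg]]] fH [sA cA AH nA eA].
have f1 : f 1 = 1 by apply: (@mulgI G (f 1)); rewrite -fM !mulg1.
split.
- exact: image_subgroup sA.
- exact: image_closed cA.
- by rewrite -[H]fH; exact: image_subset.
- by rewrite -fH; exact: image_normalizes nA.
- by have := over_image fM fK gK cf cg eA; rewrite image_set1 f1.
Qed.

Lemma characteristic_residual H R : characteristic H -> coelementary H R ->
  (forall A, coelementary H A -> R `<=` A) -> characteristic R.
Proof.
move=> cH eR mR; apply: (@automorphism_fixed (coelementary H)); last by left.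
by move=> f af; apply: coelementary_image => //; exact: cH.
Qed.

Lemma characteristic_radical H R : characteristic H -> normal_elementary H R ->
  (forall A, normal_elementary H A -> A `<=` R) -> characteristic R.
Proof.
move=> cH eR mR; apply: (@automorphism_fixed (normal_elementary H)).
  by move=> f af; apply: normal_elementary_image => //; exact: cH.
by right.
Qed.

Lemma characteristic_setT : characteristic [set: G].
Proof.
move=> f [_ _ [g [_ gK _]]]; apply/seteqP; split => // x _.
by exists (g x).
Qed.

End Characteristic.

Theorem theorem1p10 (G : topGroupType) (hG : tdlcsc G) :
  exists (N Q : subgroup G)
         (chN : characteristic N) (chQ : characteristic Q),
    [/\ closed N, closed Q, [set 1] `<=` N & N `<=` Q] /\
    [/\ elementary (subgroup_type N),
        elementary (quotient_group (characteristic_normal_subgroup chQ)) &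
        elementary_free
          (quotient_group
            (restrict_normal_subgroup Q
              (characteristic_normal_subgroup chN)))].
Proof.
have [hausG _ _ scG] := hG; have [U bU] := exists_subgroup_basis hG.
have [Q eQ minQ] :=
  exists_residual hausG bU scG (subgroup_setT G) closedT.
have [sQ cQ nQ eGQ] := eQ.
have [N eN maxN] := exists_radical hausG bU scG sQ cQ.
have [sN cN NQ nN e1N] := eN.
have chQ : characteristic (to_subgroup sQ).
  exact: characteristic_residual characteristic_setT eQ minQ.
have chN : characteristic (to_subgroup sN).
  exact: characteristic_radical chQ eN maxN.
have c1 : closed [set (1 : G)].
  exact/accessible_closed_set1/hausdorff_accessible.
exists (to_subgroup sN), (to_subgroup sQ), chN, chQ; split.
  by split => // x ->; exact: sub1.
have QE : Q = setT `&` idfun @^-1` Q by rewrite setTI.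
have NE : N = setT `&` idfun @^-1` N by rewrite setTI.
split.
- exact: over_elementary hG c1 cN
    (presents_subgroup (K := to_subgroup sN) (presents_id G) NE) e1N.
- exact: over_elementary hG cQ closedT
    (presents_quotient (K := characteristic_normal_subgroup chQ)
      (presents_id G) QE) eGQ.
set X := quotient_group _.
have [p pP] : exists p : G -> X, presents Q N p.
  have qP := presents_subgroup (K := to_subgroup sQ) (presents_id G) QE.
  have vE x : Q x ->
      val (insubd (1 : subgroup_type (to_subgroup sQ)) (idfun x)) = x.
    by move=> Qx; rewrite val_insubd; case: ifP => // /negP[]; exact/mem_set.
  (* The kernel of the composite [G -> Q -> Q / N] is found by pulling [N] back through [insubd],
     which is the identity on [Q]. *)
  eexists; apply: (presents_quotient qP); apply/seteqP; split=> [x Nx|x [Qx]].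
    have Qx := NQ _ Nx; split => //.
    suff : N (val (insubd (1 : subgroup_type (to_subgroup sQ)) (idfun x))) by [].
    by rewrite vE.
  move=> NvE.
  have : N (val (insubd (1 : subgroup_type (to_subgroup sQ)) (idfun x))) := NvE.
  by rewrite vE.
split; first exact: presents_tdlcsc pP.
- move=> M cM eM.
  have sM := subgroup_is_subgroup M.
  (* [A / N] is isomorphic to [M], so [A] is elementary, closed and normal in [Q]; maximality of [N]
     forces [A] into [N]. *)
  pose A := Q `&` p @^-1` M.
  have AP := presents_subgroup pP (erefl A).
  have eA := elementary_presented bU AP eM.
  have sA := pr_subgroup AP.
  have cA : closed A by exact: (pr_preimage_closed pP cQ cM).
  have nA : normalizes Q A.
    have := pr_preimage_normalizes pP (@normalizes_setT X M).
    by rewrite preimage_setT setIT.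
  have AN : A `<=` N.
    apply: maxN; split => //; first by move=> x [].
    apply: (over_extension hausG bU sA cA sN cN _ _ eA e1N).
      by apply: normalizes_sub nN => x [].
    exact: normalizes_set1.
  apply/seteqP; split=> [z Mz|_ ->]; last exact: sub1.
  have [x Qx xz] := pr_surj pP z.
  have Nx : N x by apply: AN; split; rewrite /preimage /= ?xz.
  by rewrite /= -xz; apply/(pr_ker pP).
- move=> M hM eM.
  pose A := Q `&` p @^-1` M.
  have AP := presents_quotient pP (erefl A).
  have eA := elementary_presented bU AP eM.
  (* [Q / A] is elementary, so the residual [R] of [Q] lies in [A]. Being characteristic in [Q]'s
     ambient group [G], [R] is normal there and [G / R] is an extension of elementary groups;
     minimality of [Q] gives [Q ⊆ R ⊆ A]. *)
  have [R eR minR] := exists_residual hausG bU scG sQ cQ.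
  have [sR cR nR eQR] := eR.
  have chR := characteristic_residual chQ eR minR.
  have nGR : normalizes setT R.
    by move=> x h Rx _; exact: (characteristic_normal chR).
  have QR : Q `<=` R.
    apply: minQ; split => //.
    exact: (over_extension hausG bU (subgroup_setT G) closedT sQ cQ nQ nGR
      eGQ eQR).
  have QA : Q `<=` A.
    apply: subset_trans QR _; apply: minR; split => //.
    + exact: pr_kernel AP.
    (* [A] is closed as the preimage of the identity of a Hausdorff quotient. *)
    + have {1}-> : A = Q `&`
          (fun x => \pi_(quotient_group M)%qT (p x)) @^-1` [set 1].
        apply/seteqP; split=> x [Qx].
          by move=> Mx; split => //; apply/(pr_ker AP).
        by move=> /(pr_ker AP Qx).
      apply: (pr_preimage_closed AP cQ).
      exact/accessible_closed_set1/hausdorff_accessible.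
    + exact: pr_normal AP.
  apply/seteqP; split => // z _; have [x Qx <-] := pr_surj AP z.
  by apply/(pr_ker AP) => //; exact: QA.
Qed.
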